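(* Let $n>p>1$ and $F(u)=\frac{1}{2n}|1-u^2|^n$. Let $N\in\mathbb{N}$ and let $v:[a,b]\to\{-1,1\}$ be a piecewise constant function with exactly $N$ jumps, located at $a<h_1<h_2<\dots<h_N<b$. For $\varepsilon>0$ let $u^\varepsilon$ be the solution to $$u_t=\varepsilon^p(|u_x|^{p-2}u_x)_x-F'(u),\qquad x\in(a,b),\ t>0,$$ with homogeneous Neumann boundary conditions $u_x(a,t)=u_x(b,t)=0$ for $t>0$ and initial datum $u^\varepsilon(\cdot,0)=u_0^\varepsilon$. Assume that $$\lim_{\varepsilon\to0}\|u_0^\varepsilon-v\|_{L^1}=0$$ and that there exists $m\in\mathbb{N}$, $m\geq 1$, such that $$E_\varepsilon[u_0^\varepsilon]\le Nc_p+\varepsilon^{k_m}\qquad\text{for all sufficiently small }\varepsilon>0.$$ Then, for any $l>0$, $$\sup_{0\le t\le l\varepsilon^{-k_m}}\|u^\varepsilon(\cdot,t)-v\|_{L^1}\longrightarrow0\qquad\text{as }\varepsilon\to0.$$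
   Context: $[a,b]$ is a fixed bounded interval and $L^1=L^1(a,b)$. The renormalized energy is $$E_\varepsilon[u]=\int_a^b\left[\frac{\varepsilon^{p-1}|u_x|^p}{p}+\frac{F(u)}{\varepsilon}\right]dx$$ (equal to $+\infty$ if the integral diverges), and $$c_p=\left(\frac{p}{p-1}\right)^{\frac{p-1}{p}}\int_{-1}^{1}F(s)^{\frac{p-1}{p}}\,ds.$$ The sequence $(k_m)_{m\ge1}$ is defined by $k_1=0$, $k_2=\alpha$, $k_{m+1}=\alpha(k_m+1)$ for $m\ge2$, where $\alpha=\frac{p-1}{p}+\frac1n$. *)

(* Defs.v *)
(* MathComp-Analysis, over an arbitrary [R : realType]. *)
From HB Require Import structures.
From mathcomp Require Export all_boot all_order all_algebra.
From mathcomp Require Export all_classical all_reals all_analysis.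
Export Order.TTheory GRing.Theory Num.Theory.
Export numFieldNormedType.Exports.

Set Implicit Arguments.
Unset Strict Implicit.
Unset Printing Implicit Defensive.

Global Open Scope classical_set_scope.
Global Open Scope ring_scope.

(* The double-well potential; the exponent [n] is real. *)
Definition potential (R : realType) (n u : R) : R :=
  (2 * n)^-1 * `|1 - u ^+ 2| `^ n.

Definition c_ (R : realType) (n p : R) : R :=
  (p / (p - 1)) `^ ((p - 1) / p) *
  \int[@lebesgue_measure R]_(s in `[-1, 1]) (potential n s `^ ((p - 1) / p)).

Definition alpha (R : realType) (n p : R) : R := (p - 1) / p + n^-1.

(* Only the indices [m >= 1] are meaningful; the value at [0] is junk. *)
Fixpoint kseq (R : realType) (n p : R) (m : nat) : R :=
  match m with
  | 0 | 1 => 0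
  | 2 => alpha n p
  | m'.+1 => alpha n p * (kseq n p m' + 1)
  end.

Definition L1norm (R : realType) (a b : R) (f : R -> R) : \bar R :=
  (\int[@lebesgue_measure R]_(x in `[a, b]) `|f x|%:E)%E.

(* [f] is absolutely continuous on [a, b] with derivative [g] almost
   everywhere, expressed through the fundamental theorem of calculus. *)
Definition ac_deriv (R : realType) (a b : R) (f g : R -> R) : Prop :=
  (@lebesgue_measure R).-integrable `[a, b] (EFin \o g) /\
  forall x, a <= x <= b ->
    f x = f a + \int[@lebesgue_measure R]_(y in `[a, x]) g y.

(* [f], as an almost-everywhere class, belongs to W^{1,1}(a, b) and [g] is its
   weak derivative: in one dimension W^{1,1}(a, b) consists of the functions
   having an absolutely continuous representative. *)
Definition weak_deriv (R : realType) (a b : R) (f g : R -> R) : Prop :=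
  exists2 f1 : R -> R, ac_deriv a b f1 g &
    {ae @lebesgue_measure R, forall x, a <= x <= b -> f x = f1 x}.

(* The weak derivative is unique almost everywhere, so this is an infimum over
   at most one value; it is +oo when [w] has no weak derivative. *)
Definition energy (R : realType) (n p a b eps : R) (w : R -> R) : \bar R :=
  ereal_inf [set (\int[@lebesgue_measure R]_(x in `[a, b])
      (eps `^ (p - 1) * `|g x| `^ p / p + potential n (w x) / eps)%:E)%E
    | g in [set g | weak_deriv a b w g]].

(* |q|^(p-2) q; at [q = 0] the value is [0] for every [p]. *)
Definition pflux (R : realType) (p q : R) : R := `|q| `^ (p - 2) * q.

(* [v] takes values in {-1, 1} on [a, b], is constant on every subinterval free
   of the points [h i], and its one-sided limits differ at each [h i]; the
   values at the jump points themselves are not prescribed. *)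
Definition piecewise_const_jumps (R : realType) (a b : R) (N : nat)
    (h : 'I_N -> R) (v : R -> R) : Prop :=
  [/\ (forall i, a < h i < b) /\
        (forall i j : 'I_N, (i < j)%N -> h i < h j),
      forall x, a <= x <= b -> v x = -1 \/ v x = 1,
      forall x y, a <= x -> x <= y -> y <= b ->
        (forall i, ~ (x <= h i <= y)) -> v x = v y &
      forall i, exists l r : R,
        [/\ v z @[z --> (h i)^'-] --> l, v z @[z --> (h i)^'+] --> r & l <> r]].

(* Strong (L^2-valued) solutions of
     u_t = eps^p (|u_x|^(p-2) u_x)_x - F'(u),  u_x(a, t) = u_x(b, t) = 0,
   in the usual sense for gradient flows in L^2(a, b):
   u is in C([0, oo); L^2) and in W^{1,2}_loc((0, oo); L^2), and for almost
   every t > 0 the equation holds almost everywhere in x, the flux being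
   absolutely continuous in x.  The weak derivative [q] of [u t] is selected so
   that its flux is continuous up to the boundary, which gives a meaning to the
   Neumann conditions.  The first argument of [u] is time. *)
Definition neumann_solution (R : realType) (n p a b eps : R)
    (u0 : R -> R) (u : R -> R -> R) : Prop :=
  let M := measurableTypeR R in
  let mu := @lebesgue_measure R in
  [/\ forall x, a <= x <= b -> u 0 x = u0 x,
      forall t : R, 0 <= t ->
        measurable_fun (`[a, b] : set M) (u t : M -> M) /\
        mu.-integrable `[a, b] (fun x => (u t x ^+ 2)%:E),
      (\int[mu]_(x in `[a, b]) ((u t x - u 0 x) ^+ 2)%:E)%E
        @[t --> 0^'+] --> (0 : \bar R)%E &
      exists ut : R -> R -> R,
        [/\ measurable_fun ((`]0, +oo[ : set M) `*` (`[a, b] : set M))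
              (fun z : M * M => ut z.1 z.2 : M),
            forall s t : R, 0 < s -> s < t ->
              (mu \x mu)%E.-integrable ((`[s, t] : set M) `*` (`[a, b] : set M))
                (fun z : M * M => (ut z.1 z.2 ^+ 2)%:E),
            forall s t : R, 0 < s -> s < t ->
              {ae mu, forall x, a <= x <= b ->
                u t x - u s x = \int[mu]_(r in `[s, t]) ut r x} &
            {ae mu, forall t : R, 0 < t ->
              exists q w : R -> R,
                [/\ weak_deriv a b (u t) q,
                    ac_deriv a b (fun x => pflux p (q x)) w,
                    q a = 0 /\ q b = 0 &
                    {ae mu, forall x, a <= x <= b ->
                      ut t x = eps `^ p * w x - derive1 (potential n) (u t x)}]}]].

(* Main.v *)
Require Import Defs.
From mathcomp Require Import measurable_realfun.
From mathcomp Require Import ring lra.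

(** The argument is the energy method for slow motion.

    The energy is almost minimal at time 0, and it is dissipated at the rate
    [eps^-1 |u_t|^2], where [|.|] is the norm of [L2]. If the energy cannot
    drop by more than [O(eps `^ k)] with [k = kseq n p m], then on the time
    interval [0, l eps `^ (- k)] the Cauchy-Schwarz inequality bounds the
    displacement in [L1] by [O(sqrt (eps `^ (- k) * eps * eps `^ k))], that is
    by [O(sqrt eps)].

    _The lower bound on the energy_ ([static_bound]). By Young's inequality the
    energy density is at least [psi u * |u_x|], where [psi] is a multiple of
    [F `^ ((p - 1) / p)] whose integral over [-1, 1] is [c_ n p]. So a function
    going from an [eta]-neighbourhood of one well to an [eta]-neighbourhood of
    the other one has energy at least [c_ n p - O(eta `^ (n * alpha))]
    ([transition_energy]). Suppose that the energy near each jump is already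
    known to be at least [c_ n p - O(eps `^ k)]. Then only [O(eps `^ k)] is left
    elsewhere, so that slightly farther from the jump there are points with
    [F u = O(eps `^ (1 + k))] ([good_point]), hence with
    [eta `^ n = O(eps `^ (1 + k))], and the error improves to
    [O(eps `^ (alpha * (k + 1)))]. Iterating this on nested neighbourhoods of
    the jumps produces the sequence [kseq].

    _The flow._ The potential satisfies [F'' >= -1], so the energy is convex up
    to a multiple of [|.|^2], and a solution of the equation at a fixed time
    provides a subgradient ([subdifferential_le]). Everything that is needed
    about the evolution is drawn from these inequalities by Gronwall's lemma
    ([flow_gronwall]): the energy decreases ([energy_le_mono]), and its drop
    over a time step bounds the displacement ([energy_dissipation]). A
    continuity argument in time ([metastability]) then keeps the solution in
    the neighbourhood of [v] where the lower bound applies. *)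

Set Implicit Arguments.
Unset Strict Implicit.
Unset Printing Implicit Defensive.

(** * Real induction, a Gronwall inequality, and the exponents *)

Section real_tools.
Context {R : realType}.
Implicit Types a b s t : R.

(** The supremum of the initial segments on which [P] holds belongs to such a
    segment by the last hypothesis; by the second one it can only be [b]. *)
Lemma real_induction (P : R -> Prop) a b :
  P a ->
  (forall t, a <= t < b -> (forall s, a <= s <= t -> P s) ->
    exists2 t', t < t' & forall s, t < s <= t' -> s <= b -> P s) ->
  (forall t, a < t <= b -> (forall s, a <= s < t -> P s) -> P t) ->
  forall t, a <= t <= b -> P t.
Proof.
move=> Pa Pstep Plim t0 /andP[at0 t0b].
pose A := [set t | a <= t <= b /\ forall s, a <= s <= t -> P s].
have Aa : A a.
  split; first by rewrite lexx (le_trans at0).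
  by move=> s sa; rewrite (_ : s = a)//; apply/eqP; rewrite eq_le andbC.
have supA : has_sup A.
  by split; [exists a | exists b => x [/andP[]]].
set c := sup A.
have ac : a <= c by apply: ub_le_sup Aa; case: supA.
have cb : c <= b by apply: ge_sup; [exists a | move=> x [/andP[]]].
have Pc1 s : a <= s < c -> P s.
  move=> /andP[as_ sc].
  have [x [xab Px] sx] := sup_adherent (eqbRL (subr_gt0 _ _) sc) supA.
  by apply: Px; rewrite as_ /= ltW// -(subKr c s).
have Pc : P c.
  have [<-//|ac'] := eqVneq a c.
  by apply: Plim => //; rewrite cb andbT lt_neqAle ac'.
have Pcc s : a <= s <= c -> P s.
  move=> /andP[as_]; rewrite le_eqVlt => /predU1P[->//|sc].
  by apply: Pc1; rewrite as_.
suff bc : b <= c by apply: Pcc; rewrite at0 (le_trans t0b).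
rewrite leNgt; apply/negP => cltb.
have [|t' ct' Pt'] := Pstep c _ Pcc; first by rewrite ac.
have : A (Num.min t' b).
  split.
    by rewrite le_min (le_trans ac (ltW ct')) (le_trans ac cb) ge_min lexx orbT.
  move=> s /andP[as_]; rewrite le_min => /andP[st' sb].
  have [sc|cs] := leP s c; first by apply: Pcc; rewrite as_.
  by apply: Pt'; rewrite // cs.
move=> /(ub_le_sup (proj2 supA)).
by rewrite leNgt lt_min ct' cltb.
Qed.

(** Gronwall's inequality for a continuous [y] whose increments over short steps
    are under control. The rate in the exponential is 2 rather than 1: the spare unit absorbs the
    oscillation of [y] over a short step, and [Gam] enters only through its
    increments, which become negligible after multiplication by the step. *)
Lemma gronwall_increments (y Gam : R -> R) (s0 T K : R) :
  s0 <= T -> 0 <= K ->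
  (forall t, s0 <= t <= T -> 0 <= y t) ->
  (forall t, s0 <= t <= T -> forall e : R, 0 < e -> exists2 d : R, 0 < d &
     forall s, s0 <= s <= T -> `|s - t| < d -> `|y s - y t| <= e) ->
  (forall s t, s0 <= s -> s <= t -> t <= T -> Gam s <= Gam t) ->
  (forall s t Y, s0 <= s -> s < t -> t <= T ->
     (forall r, s <= r <= t -> y r <= Y) ->
     y t - y s <= (t - s) * (K + Y + 2 * (Gam t - Gam s))) ->
  y T + K <= expR (2 * (T - s0)) * (y s0 + K).
Proof.
move=> s0T K0 y0 ycont Gmon yinc.
have expR1 (x : R) : 0 <= x -> 1 <= expR x.
  by move=> x0; rewrite (le_trans _ (expR_ge1Dx x))// lerDl.
pose Z k t := (y s0 + K + k + k * (Gam t - Gam s0)) * expR (2 * (t - s0)).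
have Zmon (k : R) s t : 0 < k -> s0 <= s -> s <= t -> t <= T ->
    Z k s + (2 * (t - s)) * Z k s + k * (Gam t - Gam s) <= Z k t.
  move=> k0 s0s st tT; rewrite /Z.
  have G1 : 0 <= Gam s - Gam s0 by rewrite subr_ge0 Gmon// (le_trans st).
  have G2 : 0 <= Gam t - Gam s by rewrite subr_ge0 Gmon.
  set X := y s0 + _ + _ + _.
  have X0 : 0 <= X.
    by rewrite /X !addr_ge0 ?mulr_ge0 ?(ltW k0) ?y0 ?lexx ?s0T.
  have e2 := expR_ge1Dx (2 * (t - s)).
  have e0 : 1 <= expR (2 * (s - s0)) by apply: expR1; lra.
  have e1 : 1 <= expR (2 * (t - s)) by apply: expR1; lra.
  have -> : expR (2 * (t - s0)) = expR (2 * (s - s0)) * expR (2 * (t - s)).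
    by rewrite -expRD; congr expR; ring.
  move: (expR _) (expR (2 * (t - s))) e0 e1 e2 => E0 E1 e0 e1 e2.
  have h1 : X * E0 * (1 + 2 * (t - s)) <= X * E0 * E1.
    by rewrite ler_wpM2l// mulr_ge0// (le_trans _ e0).
  have h2 : k * (Gam t - Gam s) * 1 <= k * (Gam t - Gam s) * (E0 * E1).
    rewrite ler_wpM2l//; first by rewrite mulr_ge0 ?(ltW k0).
    by rewrite -[leLHS]mulr1 ler_pM.
  have -> : y s0 + K + k + k * (Gam t - Gam s0) = X + k * (Gam t - Gam s).
    by rewrite /X; ring.
  lra.
have Zk (k : R) : 0 < k -> k <= 1 -> forall t, s0 <= t <= T -> y t + K <= Z k t.
  move=> k0 k1.
  have Zgek t : s0 <= t <= T -> k <= Z k t.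
    move=> /andP[s0t tT]; rewrite /Z -[leLHS]mulr1 ler_pM ?(ltW k0)//.
      have : 0 <= y s0 by rewrite y0 ?lexx.
      have : 0 <= k * (Gam t - Gam s0).
        by rewrite mulr_ge0 ?(ltW k0)// subr_ge0 Gmon.
      lra.
    by apply: expR1; rewrite mulr_ge0 ?subr_ge0.
  apply: real_induction.
  - by rewrite /Z !subrr !mulr0 expR0 mulr1 addr0 lerDl ltW.
  - move=> t /andP[s0t tT] /(_ t); rewrite s0t lexx => /(_ isT) IH.
    have tT' : s0 <= t <= T by rewrite s0t ltW.
    (* on [t, t + min (d / 2) (k / 2)] the oscillation of y is at most k ^+ 2 <= Z k t
     and the increment of Gam is multiplied by at most k *)
    have [|d d0 yd] := ycont t tT' (k ^+ 2); first by rewrite exprn_gt0.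
    exists (t + Num.min (d / 2) (k / 2)).
      by rewrite ltrDl lt_min !divr_gt0.
    move=> s /andP[ts]; rewrite -lerBlDl le_min => /andP[sd sk] sT.
    have := Zmon k t s k0 s0t (ltW ts) sT.
    have yr r : t <= r <= s -> y r <= y t + k ^+ 2.
      move=> /andP[tr rs]; rewrite -lerBlDl (le_trans (ler_norm _))// yd//.
        by rewrite (le_trans s0t tr) (le_trans rs).
      by rewrite ger0_norm ?subr_ge0//; lra.
    have := yinc t s _ s0t ts sT yr.
    have := Zgek t tT'.
    have : 0 <= Gam s - Gam t by rewrite subr_ge0 Gmon// ltW.
    move: IH; set D := Gam s - Gam t; set Zt := Z k t; set Zs := Z k s => IH.
    move=> D0 kZ h1 h2.
    have st0 : 0 < s - t by rewrite subr_gt0.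
    have k2 : k ^+ 2 <= Zt by rewrite (le_trans _ kZ)// expr2 -[leRHS]mulr1 ler_pM2l.
    have h3 : (s - t) * (2 * D) <= k * D by rewrite mulrA ler_wpM2r//; lra.
    have h4 : (s - t) * (K + (y t + k ^+ 2)) <= (s - t) * (Zt + Zt).
      by rewrite ler_pM2l//; lra.
    rewrite mulrDr in h1; lra.
  - move=> t /andP[s0t tT] IH; apply/ler_addgt0Pr => e e0.
    have tT' : s0 <= t <= T by rewrite tT ltW.
    have [d d0 yd] := ycont t tT' e e0.
    pose s := Num.max s0 (t - d / 2).
    have st : s < t by rewrite gt_max s0t /= ltrBlDr ltrDl divr_gt0.
    have s0s : s0 <= s by rewrite le_max lexx.
    have sT : s <= T by rewrite (le_trans (ltW st)).
    have sd : t - d / 2 <= s by rewrite le_max lexx orbT.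
    move: s sd s0s st sT => s sd s0s st sT.
    have : `|y s - y t| <= e.
      apply: yd; first by rewrite s0s.
      rewrite distrC ger0_norm ?subr_ge0 ?(ltW st)//; lra.
    rewrite distrC => /(le_trans (ler_norm _)) h1.
    have := IH s; rewrite s0s st => /(_ isT) h2.
    have := Zmon k s t k0 s0s (ltW st) tT.
    have : 0 <= Gam t - Gam s by rewrite subr_ge0 Gmon// ltW.
    have := Zgek s; rewrite s0s sT => /(_ isT).
    move: h2; set D := Gam t - Gam s; set Zt := Z k t; set Zs := Z k s => h2.
    move=> kZ D0 h3.
    have : 0 <= k * D by rewrite mulr_ge0// ltW.
    have : 0 <= 2 * (t - s) * Zs.
      apply: mulr_ge0; last by apply: (le_trans _ kZ); apply: ltW.
      by rewrite mulr_ge0 ?ler0n// subr_ge0 ltW.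
    lra.
apply/ler_addgt0Pr => e e0.
set P := 1 + (Gam T - Gam s0).
have P0 : 0 < P by rewrite ltr_pwDl// subr_ge0 Gmon.
have X0 := expR_gt0 (2 * (T - s0)).
pose k := Num.min 1 (e / (P * expR (2 * (T - s0)))).
have k0 : 0 < k by rewrite lt_min ltr01 divr_gt0// mulr_gt0.
have := Zk k k0 _ T; rewrite s0T lexx ge_min lexx => /(_ isT isT) /le_trans; apply.
rewrite /Z -addrA mulrDl mulrC lerD2l -[X in X + _]mulr1 -mulrDr -/P -mulrA.
by rewrite -ler_pdivlMr ?mulr_gt0// ge_min lexx orbT.
Qed.

Lemma alpha_gt0 (n p : R) : 1 < p -> p < n -> 0 < alpha n p.
Proof.
move=> p1 pn; rewrite /alpha addr_gt0// ?invr_gt0 ?divr_gt0//; lra.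
Qed.

Lemma kseqS (n p : R) m : kseq n p m.+2 = alpha n p * (kseq n p m.+1 + 1).
Proof. by case: m => //=; rewrite add0r mulr1. Qed.

Lemma kseq_nondecreasing (n p : R) i j : 1 < p -> p < n -> (1 <= i <= j)%N ->
  0 <= kseq n p i <= kseq n p j.
Proof.
move=> p1 pn; have a0 := ltW (alpha_gt0 p1 pn).
have step m : 0 <= kseq n p m.+1 <= kseq n p m.+2.
  elim: m => [|m /andP[k0 kS]]; first by rewrite /= lexx.
  have k2 : 0 <= kseq n p m.+2 by rewrite kseqS mulr_ge0// addr_ge0.
  by rewrite k2 (kseqS n p m.+1) [leLHS]kseqS ler_wpM2l ?lerD2r.
case: i => // i /=; elim: j => // j IH; rewrite leq_eqVlt => /predU1P[[->]|].
  by rewrite lexx andbT; have /andP[] := step j.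
rewrite ltnS => ij; have /andP[-> /le_trans] := IH ij; apply.
by case: j ij {IH} => // j _; have /andP[] := step j.
Qed.

End real_tools.

(** * The power nonlinearity and the double-well potential *)

Section power_nonlinearity.
Context {R : realType}.
Implicit Types (p q n u w x y : R).

Lemma pflux0 p : pflux p 0 = 0.
Proof. by rewrite /pflux mulr0. Qed.

Lemma normr_pflux p q : 1 < p -> `|pflux p q| = `|q| `^ (p - 1).
Proof.
move=> p1; have [->|q0] := eqVneq q 0.
  by rewrite pflux0 normr0 powR0// subr_eq0 gt_eqF.
rewrite /pflux normrM ger0_norm ?powR_ge0//.
rewrite -[X in _ * X]powRr1// -powRD.
  by congr (_ `^ _); ring.
by rewrite normr_eq0 q0 implybT.
Qed.

Lemma pfluxM p q : 1 < p -> pflux p q * q = `|q| `^ p.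
Proof.
move=> p1; have [->|q0] := eqVneq q 0.
  by rewrite mulr0 normr0 powR0// gt_eqF// (lt_trans _ p1).
rewrite /pflux -mulrA -expr2 -real_normK ?num_real// -powR_mulrn// -powRD.
  by congr (_ `^ _); ring.
by rewrite normr_eq0 q0 implybT.
Qed.

(** The graph of the convex function [`|x| `^ p / p] lies above its tangents;
    this is Young's inequality applied to [pflux p x * y]. *)
Lemma powR_tangent p x y : 1 < p ->
  `|x| `^ p / p + pflux p x * (y - x) <= `|y| `^ p / p.
Proof.
move=> p1.
have p0 : 0 < p by lra.
have q0 : 0 < p / (p - 1) by rewrite divr_gt0//; lra.
have : pflux p x * y <= `|y| `^ p / p + `|x| `^ p / (p / (p - 1)).
  rewrite (le_trans (ler_norm _))// normrM normr_pflux// mulrC.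
  have -> : `|x| `^ p = (`|x| `^ (p - 1)) `^ (p / (p - 1)).
    by rewrite -powRrM; congr (_ `^ _); field; lra.
  apply: conjugate_powR; rewrite ?powR_ge0//.
  by field; lra.
have -> : `|x| `^ p / (p / (p - 1)) = `|x| `^ p - `|x| `^ p / p.
  by field; apply/andP; split; lra.
rewrite mulrBr pfluxM//; lra.
Qed.

Lemma continuous_normr_powR p : 0 < p -> continuous (fun x => `|x| `^ p).
Proof.
move=> p0 x; have [->|x0] := eqVneq x 0.
  apply/cvgrPdist_lt => e e0.
  have ne : \forall y \near (0 : R), `|y| < e `^ p^-1.
    by apply: pseudometric_normed_Zmodule.nbhs0_lt; rewrite powR_gt0.
  near=> y.
  rewrite normr0 powR0 ?gt_eqF// sub0r normrN ger0_norm ?powR_ge0//.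
  rewrite [ltRHS](_ : _ = (e `^ p^-1) `^ p); last first.
    by rewrite -powRrM mulVf ?gt_eqF// powRr1// ltW.
  rewrite gt0_ltr_powR ?nnegrE ?powR_ge0//.
  near: y; exact: ne.
have cp : {for `|x|, continuous (fun y => y `^ p)}.
  apply/differentiable_continuous; rewrite -derivable1_diffP.
  by apply: derivable_powR; rewrite in_itv/= andbT normr_gt0.
apply: (@continuous_comp _ _ _ (fun y : R => `|y|) (fun y => y `^ p)) cp.
exact: norm_continuous.
Unshelve. all: by end_near. Qed.

Lemma is_derive_normr_powR n x : 1 < n ->
  is_derive x 1 (fun y => `|y| `^ n) (n * pflux n x).
Proof.
move=> n1; have [x0|x0|->] := ltgtP x 0.
- apply: (@near_eq_is_derive _ _ _ (fun y => (- y) `^ n)).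
    by near=> y; rewrite ltr0_norm//; near: y; exact: lt_nbhsl.
  rewrite /pflux ltr0_norm//.
  have Nx0 : 0 < - x by rewrite oppr_gt0.
  have := @is_derive1_comp _ (fun y => y `^ n) (fun y : R => - y) x
    (n * (- x) `^ (n - 1)) (-1) (is_derive1_powR _ Nx0) _.
  have -> : n * ((- x) `^ (n - 2) * x) = n * (- x) `^ (n - 1) * -1.
    rewrite -(mulr_powRB1 (ltW Nx0) (_ : 0 < n - 1)) ?subr_gt0//.
    by rewrite (_ : n - 1 - 1 = n - 2); ring.
  by apply; exact: is_deriveNid.
- apply: (@near_eq_is_derive _ _ _ (fun y => y `^ n)).
    by near=> y; rewrite gtr0_norm//; near: y; exact: lt_nbhsr.
  rewrite /pflux gtr0_norm//.
  have -> : n * (x `^ (n - 2) * x) = n * x `^ (n - 1).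
    rewrite -(mulr_powRB1 (ltW x0) (_ : 0 < n - 1)) ?subr_gt0//.
    by rewrite (_ : n - 1 - 1 = n - 2); ring.
  exact: is_derive1_powR.
- rewrite pflux0 mulr0.
  have n0 : 0 < n - 1 by rewrite subr_gt0.
  have cv : h^-1 *: (((fun y : R => `|y| `^ n) \o shift 0) (h *: 1) - `|0 : R| `^ n)
      @[h --> (0 : R)^'] --> (0 : R).
    apply/cvgrPdist_lt => e e0.
    have /cvgrPdist_lt/(_ e e0) ne := @continuous_normr_powR _ n0 0.
    apply: cvg_within; near=> h.
    rewrite sub0r normrN.
    have [->|h0] := eqVneq h 0; first by rewrite invr0 scale0r normr0.
    rewrite /GRing.scale/= mulr1 addr0 (normr0 R) [0 `^ n]powR0 ?subr0; last first.
      by rewrite gt_eqF// (lt_trans _ n1).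
    rewrite normrM normfV [`|_ `^ n|]ger0_norm ?powR_ge0//.
    have -> : `|h|^-1 * `|h| `^ n = `|h| `^ (n - 1).
      rewrite -(@mulr_powRB1 _ `|h| n)// ?(lt_trans _ n1)//.
      by rewrite mulKf// normr_eq0.
    have : `| `|0 : R| `^ (n - 1) - `|h| `^ (n - 1)| < e by near: h; exact: ne.
    by rewrite normr0 powR0 ?gt_eqF// sub0r normrN ger0_norm ?powR_ge0.
  apply: DeriveDef; first by apply/cvg_ex; exists 0; exact: cv.
  exact/cvg_lim.
Unshelve. all: by end_near. Qed.

Lemma potential_ge0 n u : 0 < n -> 0 <= potential n u.
Proof. by move=> n0; rewrite mulr_ge0 ?powR_ge0// invr_ge0 mulr_ge0 ?ler0n// ltW. Qed.

Lemma is_derive_potential n u : 1 < n ->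
  is_derive u 1 (potential n) (- u * pflux n (1 - u ^+ 2)).
Proof.
move=> n1.
have d1 := @is_derive_normr_powR n (1 - u ^+ 2) n1.
have d2 : is_derive u 1 (fun y : R => 1 - y ^+ 2) (- (2 * u)).
  have d := is_deriveB (is_derive_cst (1 : R) u 1) (is_deriveX 2 (is_derive_id u (1 : R))).
  apply: (@is_derive_eq _ _ _ _ _ _ _ _ d).
  by rewrite sub0r /GRing.scale/= mulr1 expr1.
have d3 := @is_derive1_comp _ _ _ u _ _ d1 d2.
have : is_derive u 1 ((2 * n)^-1 \*: ((fun y => `|y| `^ n) \o (fun y : R => 1 - y ^+ 2)))
   ((2 * n)^-1 *: (n * pflux n (1 - u ^+ 2) * - (2 * u))) by exact: is_deriveZ.
move=> d; apply: (@is_derive_eq _ _ _ _ _ _ _ _ d).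
by rewrite /GRing.scale /=; field; lra.
Qed.

Lemma derive1_potential n u : 1 < n ->
  derive1 (potential n) u = - u * pflux n (1 - u ^+ 2).
Proof.
by move=> n1; rewrite derive1E; have := is_derive_potential u n1 => d; rewrite derive_val.
Qed.

Lemma continuous_potential n : 1 < n -> continuous (potential n).
Proof.
move=> n1 x; apply/differentiable_continuous; rewrite -derivable1_diffP.
by case: (is_derive_potential x n1).
Qed.

(** [F + u^2/2] is convex: with [A = 1 - u^2] and [F = P(A)/2] for the convex
    [P x = `|x| `^ n / n], the tangent inequality of [P] leaves the error
    [P' A * (w - u)^2 / 2], and [P' A <= 1] because [A <= 1]. *)
Lemma potential_tangent n u w : 1 < n ->
  potential n u + derive1 (potential n) u * (w - u) - (w - u) ^+ 2 / 2
    <= potential n w.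
Proof.
move=> n1; rewrite derive1_potential//.
have := powR_tangent (1 - u ^+ 2) (1 - w ^+ 2) n1.
have P2 x : potential n x = `|1 - x ^+ 2| `^ n / n / 2.
  by rewrite /potential; field; lra.
rewrite !P2.
have s1 : pflux n (1 - u ^+ 2) <= 1.
  have [A0|A0] := leP 0 (1 - u ^+ 2); last first.
    by rewrite (@le_trans _ _ 0)// /pflux mulr_ge0_le0 ?powR_ge0// ltW.
  rewrite (le_trans (ler_norm _))// normr_pflux// ger0_norm//.
  rewrite (@le_trans _ _ (1 `^ (n - 1)))//; last by rewrite powR1.
  rewrite ge0_ler_powR ?nnegrE//; first by lra.
  by have := sqr_ge0 u; lra.
move: (pflux _ _) s1 (`|_| `^ _) (`|1 - w ^+ 2| `^ _) => s s1 X Y h.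
have : 0 <= (1 - s) * (w - u) ^+ 2 by rewrite mulr_ge0 ?sqr_ge0//; lra.
by nra.
Qed.

End power_nonlinearity.

(** * Real-valued integrals and Fubini *)

#[global] Instance ae_lebesgue_filter (R : realType) :
  Filter (almost_everywhere (@lebesgue_measure R)).
Proof. exact: ae_filter_ringOfSetsType. Qed.

Section real_valued_integral.
Context d (T : measurableType d) (R : realType).
Variable mu : {measure set T -> \bar R}.
Implicit Types (A D : set T) (f g : T -> R).

Lemma integrableD_R D f g : measurable D -> mu.-integrable D (EFin \o f) ->
  mu.-integrable D (EFin \o g) -> mu.-integrable D (EFin \o (fun x => f x + g x)).
Proof. by move=> mD hf hg; have := integrableD mD hf hg. Qed.

Lemma integrableB_R D f g : measurable D -> mu.-integrable D (EFin \o f) ->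
  mu.-integrable D (EFin \o g) -> mu.-integrable D (EFin \o (fun x => f x - g x)).
Proof. by move=> mD hf hg; have := integrableB mD hf hg. Qed.

Lemma integrableZ_R D f (k : R) : measurable D -> mu.-integrable D (EFin \o f) ->
  mu.-integrable D (EFin \o (fun x => k * f x)).
Proof. by move=> mD hf; have := integrableZl mD k hf. Qed.

Lemma measurable_integrable D f : mu.-integrable D (EFin \o f) -> measurable_fun D f.
Proof. by move=> /measurable_int /measurable_EFinP. Qed.

Lemma dominated_integrable D f g : measurable D -> measurable_fun D f ->
  (forall x, D x -> `|f x| <= g x) -> mu.-integrable D (EFin \o g) ->
  mu.-integrable D (EFin \o f).
Proof.
move=> mD mf fg; apply: le_integrable => //; first exact/measurable_EFinP.
by move=> x Dx /=; rewrite lee_fin (le_trans (fg x Dx))// ler_norm.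
Qed.

Lemma ae_le_Rintegral D f g : measurable D -> mu.-integrable D (EFin \o f) ->
  mu.-integrable D (EFin \o g) -> {ae mu, forall x, D x -> f x <= g x} ->
  \int[mu]_(x in D) f x <= \int[mu]_(x in D) g x.
Proof.
move=> mD hf hg fg.
pose f' := fun x => Num.min (f x) (g x).
have mf := measurable_integrable hf; have mg := measurable_integrable hg.
have mf' : measurable_fun D f' by exact: measurable_minr.
have hf' : mu.-integrable D (EFin \o f').
  apply: (@dominated_integrable _ _ (fun x => `|f x| + `|g x|)) => //.
    move=> x _; rewrite /f' /Num.min; case: ifP => _.
      by rewrite lerDl.
    by rewrite lerDr.
  by apply: integrableD_R => //; exact: integrable_norm.
apply: (@le_trans _ _ (\int[mu]_(x in D) f' x)); last first.
  by apply: le_Rintegral => // x _; rewrite /f' ge_min lexx orbT.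
rewrite le_eqVlt; apply/orP; left; apply/eqP; congr fine.
apply: ae_eq_integral => //; [exact/measurable_EFinP|exact/measurable_EFinP|].
by apply: filterS fg => x /= fg Dx; rewrite /f' min_l// fg.
Qed.

Lemma ae_eq_Rintegral D f g : measurable D -> measurable_fun D f ->
  measurable_fun D g -> {ae mu, forall x, D x -> f x = g x} ->
  \int[mu]_(x in D) f x = \int[mu]_(x in D) g x.
Proof.
move=> mD mf mg fg; congr fine.
apply: ae_eq_integral => //; [exact/measurable_EFinP|exact/measurable_EFinP|].
by apply: filterS fg => x /= fg Dx; rewrite fg.
Qed.

Lemma ae_eq_integrable D f g : measurable D -> measurable_fun D g ->
  {ae mu, forall x, D x -> f x = g x} ->
  mu.-integrable D (EFin \o f) -> mu.-integrable D (EFin \o g).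
Proof.
move=> mD mg fg hf; apply/integrableP; split; first exact/measurable_EFinP.
have /integrableP[mf] := hf; rewrite (@ae_eq_integral _ _ _ mu D (abse \o (EFin \o g)))//.
- by apply: measurableT_comp.
- by apply: measurableT_comp => //; exact/measurable_EFinP.
- by apply: filterS fg => x /= fg Dx; rewrite fg.
Qed.

Lemma fine_Rintegral D f : mu.-integrable D (EFin \o f) -> measurable D ->
  (\int[mu]_(x in D) f x)%:E = (\int[mu]_(x in D) (f x)%:E)%E.
Proof. by move=> hf mD; rewrite /Rintegral fineK//; exact: integrable_fin_num. Qed.

Lemma Rintegral_subset A D f : measurable A -> measurable D -> A `<=` D ->
  mu.-integrable D (EFin \o f) -> (forall x, D x -> 0 <= f x) ->
  \int[mu]_(x in A) f x <= \int[mu]_(x in D) f x.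
Proof.
move=> mA mD AD hf f0.
have hA : mu.-integrable A (EFin \o f) by exact: integrableS hf.
rewrite -lee_fin !fine_Rintegral//.
by apply: ge0_subset_integral => //; exact: measurable_int hf.
Qed.

End real_valued_integral.

Section measurable_slices.
Context d1 d2 d3 (T1 : measurableType d1) (T2 : measurableType d2)
  (T3 : measurableType d3).
Variables (A : set T1) (B : set T2).
Hypotheses (mA : measurable A) (mB : measurable B).

Lemma measurable_fun_fst (f : T1 -> T3) : measurable_fun A f ->
  measurable_fun (A `*` B) (fun p : T1 * T2 => f p.1).
Proof.
move=> mf; apply: (measurable_comp mA _ mf (measurable_funTS measurable_fst)).
by move=> _ [p [p1 p2] <-].
Qed.

Lemma measurable_fun_snd (f : T2 -> T3) : measurable_fun B f ->
  measurable_fun (A `*` B) (fun p : T1 * T2 => f p.2).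
Proof.
move=> mf; apply: (measurable_comp mB _ mf (measurable_funTS measurable_snd)).
by move=> _ [p [p1 p2] <-].
Qed.

End measurable_slices.

Section integrable_product.
Context d1 d2 (T1 : measurableType d1) (T2 : measurableType d2) (R : realType).
Variable m1 : {sigma_finite_measure set T1 -> \bar R}.
Variable m2 : {sigma_finite_measure set T2 -> \bar R}.
Variables (A : set T1) (B : set T2) (f : T1 -> R) (g : T2 -> R).
Hypotheses (mA : measurable A) (mB : measurable B).

Lemma integrable_prod : m1.-integrable A (EFin \o f) -> m2.-integrable B (EFin \o g) ->
  (m1 \x m2)%E.-integrable (A `*` B) (EFin \o (fun p => f p.1 * g p.2)).
Proof.
move=> hf hg.
have mf := measurable_integrable hf; have mg := measurable_integrable hg.
have mAB : measurable (A `*` B) by exact: measurableX.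
have mfg : measurable_fun (A `*` B) (fun p : T1 * T2 => f p.1 * g p.2).
  by apply: measurable_funM; [exact: measurable_fun_fst|exact: measurable_fun_snd].
apply: (iffRL (integrable_mkcond _ mAB)).
have hf' := iffLR (integrable_mkcond _ mA) hf.
have hg' := iffLR (integrable_mkcond _ mB) hg.
rewrite restrict_EFin in hf'; rewrite restrict_EFin in hg'; rewrite restrict_EFin.
apply/integrable12ltyP.
  apply/measurable_EFinP. by apply: (iffLR (measurable_restrictT _ mAB)).
have E x y : ((fun p : T1 * T2 => f p.1 * g p.2) \_ (A `*` B)) (x, y) =
    (f \_ A) x * (g \_ B) y.
  rewrite !patchE in_setX /=; case: (x \in A); case: (y \in B) => //=;
  by rewrite ?mulr0 ?mul0r.
have mg' : measurable_fun setT (EFin \o (Num.Def.normr \o (g \_ B))).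
  exact: measurable_int (integrable_norm hg').
have gE x : (\int[m2]_y `|((f \_ A) x * (g \_ B) y)%:E| =
    `|(f \_ A) x|%:E * \int[m2]_y (EFin \o (Num.Def.normr \o (g \_ B))) y)%E.
  rewrite -ge0_integralZl//; last by move=> y _; rewrite /= lee_fin normr_ge0.
  by apply: eq_integral => y _; rewrite /= normrM EFinM.
under eq_integral do under eq_integral do rewrite /= E.
under eq_integral do rewrite gE.
have C0 : (0 <= \int[m2]_y (EFin \o (Num.Def.normr \o (g \_ B))) y)%E.
  by apply: integral_ge0 => y _; rewrite /= lee_fin.
rewrite ge0_integralZr//; last exact: measurable_int (integrable_norm hf').
have /integrableP[_ ff] := hf'; have /integrableP[_ gg] := hg'.
have F0 : (0 <= \int[m1]_x `|(f \_ A) x|%:E)%E.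
  by apply: integral_ge0 => x _; rewrite lee_fin.
by apply: lte_mul_pinfty => //; rewrite ge0_fin_numE.
Qed.

End integrable_product.

Section real_valued_Fubini.
Context d1 d2 (T1 : measurableType d1) (T2 : measurableType d2) (R : realType).
Variable m1 : {sigma_finite_measure set T1 -> \bar R}.
Variable m2 : {sigma_finite_measure set T2 -> \bar R}.
Variables (A : set T1) (B : set T2) (k : T1 * T2 -> R).
Hypotheses (mA : measurable A) (mB : measurable B).
Hypothesis ik : (m1 \x m2)%E.-integrable (A `*` B) (EFin \o k).

Let kr := (EFin \o k) \_ (A `*` B).

Let ikr : (m1 \x m2)%E.-integrable setT kr.
Proof. exact: (iffLR (integrable_mkcond _ (measurableX mA mB))). Qed.

Let kr1 x : A x -> (fun y => kr (x, y)) = (EFin \o (fun y => k (x, y))) \_ B.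
Proof.
by move=> Ax; apply/funext => y; rewrite /kr !patchE in_setX mem_set.
Qed.

Let kr1N x : ~ A x -> (fun y => kr (x, y)) = cst 0%E.
Proof.
by move=> Ax; apply/funext => y; rewrite /kr !patchE in_setX memNset.
Qed.

Let kr2 y : B y -> (fun x => kr (x, y)) = (EFin \o (fun x => k (x, y))) \_ A.
Proof.
by move=> By; apply/funext => x; rewrite /kr !patchE in_setX (mem_set By) andbT.
Qed.

Let kr2N y : ~ B y -> (fun x => kr (x, y)) = cst 0%E.
Proof.
by move=> By; apply/funext => x; rewrite /kr !patchE in_setX (memNset By) andbF.
Qed.

Lemma ae_integrable_slice1 :
  {ae m1, forall x, A x -> m2.-integrable B (EFin \o (fun y => k (x, y)))}.
Proof.
have := ae_integrable1 ikr; apply: filterS => x /= + Ax.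
by rewrite kr1// => /(iffRL (integrable_mkcond _ mB)).
Qed.

Lemma ae_integrable_slice2 :
  {ae m2, forall y, B y -> m1.-integrable A (EFin \o (fun x => k (x, y)))}.
Proof.
have := ae_integrable2 ikr; apply: filterS => y /= + By.
by rewrite kr2// => /(iffRL (integrable_mkcond _ mA)).
Qed.

Let F x := (\int[m2]_y kr (x, y))%E.
Let G y := (\int[m1]_x kr (x, y))%E.

Let iF : m1.-integrable setT F. Proof. exact: integrable_fubini_F ikr. Qed.
Let iG : m2.-integrable setT G.
Proof.
have mkr := measurable_int _ ikr.
have mG := measurable_fubini_G ikr.
apply/integrableP; split => //.
apply: le_lt_trans ((integrable21ltyP _ _ mkr).1 ikr).
apply: ge0_le_integral => //; first exact: measurableT_comp.
  apply: (measurable_fun_fubini_tonelli_G (abse \o kr)) => //=.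
  exact: measurableT_comp.
move=> y _; apply: le_abse_integral => //.
exact: measurableT_comp mkr _.
Qed.

Let fineF : (fun x => \int[m2]_(y in B) k (x, y)) \_ A = fine \o F.
Proof.
apply/funext => x; rewrite patchE /F /=; case: ifPn => [/set_mem Ax|/negP nAx].
  by rewrite kr1// -integral_mkcond.
by rewrite kr1N ?integral0// => Ax; apply: nAx; rewrite inE.
Qed.

Let fineG : (fun y => \int[m1]_(x in A) k (x, y)) \_ B = fine \o G.
Proof.
apply/funext => y; rewrite patchE /G /=; case: ifPn => [/set_mem By|/negP nBy].
  by rewrite kr2// -integral_mkcond.
by rewrite kr2N ?integral0// => By; apply: nBy; rewrite inE.
Qed.

Let fine_integrable d (T : measurableType d) (m : {measure set T -> \bar R})
    (H : T -> \bar R) (h : T -> R) (D : set T) : measurable D ->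
  m.-integrable setT H -> h \_ D = fine \o H ->
  m.-integrable D (EFin \o h) /\
  (\int[m]_(x in D) h x)%:E = (\int[m]_x H x)%E.
Proof.
move=> mD iH hH.
have mfH : measurable_fun setT (fine \o H).
  by apply: measurableT_comp => //; exact: measurable_int iH.
have aeH : ae_eq m setT (EFin \o (fine \o H)) H.
  have := integrable_ae measurableT iH; apply: filterS => x /= /(_ I) fH _.
  by rewrite fineK.
have E : (\int[m]_x (EFin \o (fine \o H)) x = \int[m]_x H x)%E.
  apply: ae_eq_integral => //; last exact: measurable_int iH.
  exact/measurable_EFinP.
have ifH : m.-integrable setT (EFin \o (fine \o H)).
  apply: le_integrable iH => //; first exact/measurable_EFinP.
  move=> x _ /=; by case: (H x) => [r||] /=; rewrite ?normr0 ?leey.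
have ih : m.-integrable D (EFin \o h).
  by apply: (iffRL (integrable_mkcond _ mD)); rewrite restrict_EFin hH.
by split=> //; rewrite fine_Rintegral// integral_mkcond restrict_EFin hH.
Qed.

Lemma integrable_slice1 :
  m1.-integrable A (EFin \o (fun x => \int[m2]_(y in B) k (x, y))).
Proof. by have [] := fine_integrable mA iF fineF. Qed.

Lemma integrable_slice2 :
  m2.-integrable B (EFin \o (fun y => \int[m1]_(x in A) k (x, y))).
Proof. by have [] := fine_integrable mB iG fineG. Qed.

Lemma Rintegral_Fubini : \int[m1]_(x in A) \int[m2]_(y in B) k (x, y) =
  \int[m2]_(y in B) \int[m1]_(x in A) k (x, y).
Proof.
apply/EFin_inj; rewrite (fine_integrable mA iF fineF).2.
rewrite (fine_integrable mB iG fineG).2.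
exact: Fubini ikr.
Qed.

End real_valued_Fubini.

(** * Square-integrable functions *)

Section square_integrable.
Context d (T : measurableType d) (R : realType).
Variable mu : {measure set T -> \bar R}.
Variable D : set T.
Hypothesis mD : measurable D.
Implicit Types (f g h : T -> R) (k : R).

Definition L2 f :=
  measurable_fun D f /\ mu.-integrable D (EFin \o (fun x => f x ^+ 2)).

Definition ip f g : R := \int[mu]_(x in D) (f x * g x).

Lemma L2_integrableM f g : L2 f -> L2 g ->
  mu.-integrable D (EFin \o (fun x => f x * g x)).
Proof.
move=> [mf f2] [mg g2].
apply: (@dominated_integrable _ _ _ _ _ _ (fun x => f x ^+ 2 + g x ^+ 2)) => //.
- exact: measurable_funM.
- move=> x _; rewrite normrM -(real_normK (num_real (f x))) -(real_normK (num_real (g x))).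
  have := sqr_ge0 (`|f x| - `|g x|); have : 0 <= `|f x| by []. have : 0 <= `|g x| by [].
  by rewrite !expr2; nra.
- exact: integrableD_R.
Qed.

Lemma L2Z k f : L2 f -> L2 (fun x => k * f x).
Proof.
move=> [mf f2]; split; first exact: measurable_funM.
by under [X in EFin \o X]eq_fun do rewrite exprMn; exact: integrableZ_R.
Qed.

Lemma L2D f g : L2 f -> L2 g -> L2 (fun x => f x + g x).
Proof.
move=> hf hg; have [mf f2] := hf; have [mg g2] := hg.
split; first exact: measurable_funD.
under [X in EFin \o X]eq_fun do rewrite sqrrD -mulr_natl.
apply: integrableD_R => //; apply: integrableD_R => //.
by apply: integrableZ_R => //; exact: L2_integrableM.
Qed.

Lemma L2B f g : L2 f -> L2 g -> L2 (fun x => f x - g x).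
Proof.
move=> hf hg; have := L2D hf (L2Z (-1) hg).
by under [X in L2 X]eq_fun do rewrite mulN1r.
Qed.

Lemma ipC f g : ip f g = ip g f.
Proof. by apply: eq_Rintegral => x _; rewrite mulrC. Qed.

Lemma ipD f g h : L2 f -> L2 g -> L2 h -> ip f (fun x => g x + h x) = ip f g + ip f h.
Proof.
move=> hf hg hh; rewrite /ip -RintegralD//; [|exact: L2_integrableM..].
by apply: eq_Rintegral => x _; rewrite mulrDr.
Qed.

Lemma ipB f g h : L2 f -> L2 g -> L2 h -> ip f (fun x => g x - h x) = ip f g - ip f h.
Proof.
move=> hf hg hh; rewrite /ip -RintegralB//; [|exact: L2_integrableM..].
by apply: eq_Rintegral => x _; rewrite mulrBr.
Qed.

Lemma ipZ k f g : L2 f -> L2 g -> ip f (fun x => k * g x) = k * ip f g.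
Proof.
move=> hf hg; rewrite /ip -RintegralZl//; last exact: L2_integrableM.
by apply: eq_Rintegral => x _; rewrite mulrCA.
Qed.

Lemma ip_ge0 f : 0 <= ip f f.
Proof. by apply: Rintegral_ge0 => x _; rewrite -expr2 sqr_ge0. Qed.

Lemma ip_sqrD f g : L2 f -> L2 g ->
  ip (fun x => f x + g x) (fun x => f x + g x) = ip f f + 2 * ip f g + ip g g.
Proof.
move=> hf hg; have hfg := L2D hf hg.
rewrite ipD// [ip _ f]ipC [ip _ g]ipC !ipD// [ip g f]ipC; ring.
Qed.

Lemma ip_sqrB f g : L2 f -> L2 g ->
  ip (fun x => f x - g x) (fun x => f x - g x) = ip f f - 2 * ip f g + ip g g.
Proof.
move=> hf hg; have hfg := L2B hf hg.
rewrite ipB// [ip _ f]ipC [ip _ g]ipC !ipB// [ip g f]ipC; ring.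
Qed.

Lemma ip_young k f g : 0 < k -> L2 f -> L2 g ->
  ip f g <= k / 2 * ip f f + ip g g / (2 * k).
Proof.
move=> k0 hf hg.
have := ip_ge0 (fun x => k * f x - g x); rewrite ip_sqrB//; last exact: L2Z.
have -> : ip (fun x => k * f x) (fun x => k * f x) = k ^+ 2 * ip f f.
  by rewrite ipZ//; [rewrite ipC ipZ// expr2 mulrA|exact: L2Z].
have -> : ip (fun x => k * f x) g = k * ip f g by rewrite ipC ipZ// ipC.
move=> h; rewrite -(ler_pM2l (_ : 0 < 2 * k)) ?mulr_gt0//.
have -> : 2 * k * (k / 2 * ip f f + ip g g / (2 * k)) = k ^+ 2 * ip f f + ip g g.
  by field; rewrite gt_eqF.
by lra.
Qed.

Definition L2norm f : R := Num.sqrt (ip f f).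

Lemma cauchy_schwarz f g : L2 f -> L2 g -> `|ip f g| <= L2norm f * L2norm g.
Proof.
suff H f' g' : L2 f' -> L2 g' -> ip f' g' <= L2norm f' * L2norm g'.
  move=> hf hg; rewrite ler_norml H// andbT lerNl.
  have hf' := L2Z (-1) hf.
  have := H _ _ hf' hg; rewrite [ip _ g]ipC ipZ// mulN1r [ip g f]ipC => /le_trans; apply.
  rewrite /L2norm (_ : ip _ _ = ip f f)//.
  by apply: eq_Rintegral => x _; rewrite mulrACA mulrNN !mul1r.
move=> hf hg; apply/ler_addgt0Pr => e e0.
have F0 : 0 <= L2norm f' by exact: sqrtr_ge0.
have G0 : 0 <= L2norm g' by exact: sqrtr_ge0.
have FF : ip f' f' = L2norm f' ^+ 2 by rewrite sqr_sqrtr// ip_ge0.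
have GG : ip g' g' = L2norm g' ^+ 2 by rewrite sqr_sqrtr// ip_ge0.
(* optimal weight |g| / |f|, perturbed so as to avoid dividing by zero *)
pose h := e / (L2norm f' + L2norm g' + 1).
have S0 : 0 < L2norm f' + L2norm g' + 1 by lra.
have h0 : 0 < h by rewrite divr_gt0.
have Fh : 0 < L2norm f' + h by lra.
have Gh : 0 < L2norm g' + h by lra.
have := ip_young (divr_gt0 Gh Fh) hf hg => /le_trans; apply.
rewrite FF GG; move: (L2norm f') (L2norm g') F0 G0 @h S0 h0 Fh Gh => F G F0 G0 h S0 h0 Fh Gh.
have e1 : (G + h) / (F + h) / 2 * F ^+ 2 <= (G + h) / 2 * F.
  have -> : (G + h) / (F + h) / 2 * F ^+ 2 = (G + h) / 2 * F * (F / (F + h)).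
    by field; rewrite gt_eqF.
  rewrite -[leRHS]mulr1 ler_wpM2l ?mulr_ge0//; first by lra.
  by rewrite ler_pdivrMr// mul1r lerDl ltW.
have e2 : G ^+ 2 / (2 * ((G + h) / (F + h))) <= (F + h) / 2 * G.
  have -> : G ^+ 2 / (2 * ((G + h) / (F + h))) = (F + h) / 2 * G * (G / (G + h)).
    by field; apply/andP; split; rewrite gt_eqF.
  rewrite -[leRHS]mulr1 ler_wpM2l ?mulr_ge0//; first by lra.
  by rewrite ler_pdivrMr// mul1r lerDl ltW.
have e3 : h * (F + G + 1) = e by rewrite /h divfK// gt_eqF.
by nra.
Qed.

Lemma L2norm_triangle f g : L2 f -> L2 g ->
  L2norm (fun x => f x + g x) <= L2norm f + L2norm g.
Proof.
move=> hf hg.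
have F0 : 0 <= L2norm f by exact: sqrtr_ge0.
have G0 : 0 <= L2norm g by exact: sqrtr_ge0.
rewrite -(@ler_pXn2r _ 2)// ?nnegrE ?sqrtr_ge0 ?addr_ge0//.
rewrite sqr_sqrtr ?ip_ge0// ip_sqrD// sqrrD !sqr_sqrtr ?ip_ge0//.
have := cauchy_schwarz hf hg => /(le_trans (ler_norm _)); lra.
Qed.

Lemma L2normN f : L2norm (fun x => - f x) = L2norm f.
Proof. by congr Num.sqrt; apply: eq_Rintegral => x _; rewrite mulrNN. Qed.

Lemma L2norm_distC f g : L2norm (fun x => f x - g x) = L2norm (fun x => g x - f x).
Proof. by rewrite -L2normN; congr L2norm; apply/funext => x; rewrite opprB. Qed.

Lemma L2norm_lip f g h : L2 f -> L2 g -> L2 h ->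
  `|L2norm (fun x => f x - h x) - L2norm (fun x => g x - h x)|
    <= L2norm (fun x => f x - g x).
Proof.
suff H f' g' : L2 f' -> L2 g' -> L2 h ->
    L2norm (fun x => f' x - h x) <= L2norm (fun x => f' x - g' x) + L2norm (fun x => g' x - h x).
  move=> hf hg hh; have := H _ _ hf hg hh; have := H _ _ hg hf hh.
  by rewrite (L2norm_distC g f) ler_norml => ? ?; apply/andP; split; lra.
move=> hf hg hh; rewrite -[X in X <= _](_ : L2norm (fun x => (f' x - g' x) + (g' x - h x)) = _).
  by apply: L2norm_triangle; exact: L2B.
by congr L2norm; apply/funext => x; rewrite addrA subrK.
Qed.

Lemma L2_integrable f : (mu D < +oo)%E -> L2 f -> mu.-integrable D (EFin \o f).
Proof.
move=> Doo [mf f2].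
have h1 : mu.-integrable D (EFin \o (fun=> 1 : R)).
  apply/integrableP; split; first exact: measurable_cst.
  by under eq_integral do rewrite /= normr1; rewrite integral_cst// mul1e.
apply: (@dominated_integrable _ _ _ _ _ _ (fun x => f x ^+ 2 + 1)) => //.
  move=> x _; rewrite -real_normK ?num_real//.
  by have := sqr_ge0 (`|f x| - 1); have : 0 <= `|f x| by []; nra.
exact: integrableD_R.
Qed.

End square_integrable.

(** * Absolutely continuous functions *)

Section interval_integrals.
Context {R : realType}.
Notation mu := (@lebesgue_measure R).
Implicit Types (a b x y z : R) (f g : R -> R).

Lemma Rintegral_itv_split x y z g : x <= y -> y <= z ->
  mu.-integrable `[x, z] (EFin \o g) ->
  \int[mu]_(t in `[x, z]) g t =
  \int[mu]_(t in `[x, y]) g t + \int[mu]_(t in `[y, z]) g t.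
Proof.
move=> xy yz hg.
have := @Rintegral_itvB _ g (BLeft x) (BRight z) y hg.
rewrite !bnd_simp => /(_ xy yz).
rewrite Rintegral_itv_obnd_cbnd; first by move=> <-; ring.
apply: (integrableS _ _ _ hg) => //; apply: subset_itv; rewrite ?bnd_simp//.
Qed.

Lemma integrable_subitv a b x y g : a <= x -> y <= b ->
  mu.-integrable `[a, b] (EFin \o g) -> mu.-integrable `[x, y] (EFin \o g).
Proof.
move=> ax yb; apply: integrableS => //.
by apply: subset_itv; rewrite bnd_simp.
Qed.

Lemma lebesgue_measure_itvcc x y : x <= y -> mu `[x, y] = (y - x)%:E.
Proof.
rewrite le_eqVlt lebesgue_measure_itv/= lte_fin => /predU1P[->|->//].
by rewrite ltxx subrr.
Qed.

Lemma Rintegral_itv_cst x y (k : R) : x <= y ->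
  \int[mu]_(t in `[x, y]) k = k * (y - x).
Proof. by move=> xy; rewrite Rintegral_cst//= lebesgue_measure_itvcc. Qed.

Lemma integrable_itv_cst x y (k : R) : mu.-integrable `[x, y] (EFin \o (fun=> k)).
Proof.
apply: measurable_bounded_integrable => //.
  by have := lebesgue_measure_itv `[x, y] => /= ->; case: ifP => _; rewrite ltry.
by exists `|k|; split; [exact: num_real|move=> M kM t _ /=; rewrite ltW].
Qed.

Lemma bounded_integrable_itv a b g (M : R) : measurable_fun `[a, b] g ->
  (forall x, a <= x <= b -> `|g x| <= M) -> mu.-integrable `[a, b] (EFin \o g).
Proof.
move=> mg gM.
have hM : forall x, `[a, b]%classic x -> `|g x| <= M.
  by move=> x; rewrite /= in_itv/=; exact: gM.
have iM := integrable_itv_cst a b M.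
by apply: (@dominated_integrable _ _ _ mu _ _ _ _ _ hM iM).
Qed.

Lemma Rintegral_small a b g : mu.-integrable `[a, b] (EFin \o g) ->
  forall e : R, 0 < e -> exists2 d : R, 0 < d & forall x y, a <= x -> x <= y -> y <= b ->
    y - x < d -> \int[mu]_(t in `[x, y]) `|g t| <= e.
Proof.
move=> hg e e0.
have : mu.-integrable setT (EFin \o g \_ `[a, b]).
  by rewrite -restrict_EFin; apply/integrable_restrict => //=; rewrite setTI.
move=> /integral_normr_continuous /(_ _ e0)[d [d0 /= H]].
exists d => // x y ax xy yb yxd.
have := H `[x, y]%classic (measurable_itv _); rewrite lebesgue_measure_itvcc// lte_fin.
move=> /(_ yxd)/ltW; congr (_ <= _); apply: eq_Rintegral => t.
rewrite inE/= in_itv/= => /andP[xt ty]; rewrite patchE mem_set//=.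
by rewrite in_itv/= (le_trans ax)//= (le_trans ty).
Qed.

Section absolutely_continuous.
Variables (a b : R) (f g : R -> R).
Hypothesis fg : ac_deriv a b f g.

Lemma ac_increment x y : a <= x -> x <= y -> y <= b ->
  f y - f x = \int[mu]_(t in `[x, y]) g t.
Proof.
move=> ax xy yb; have [hg H] := fg.
rewrite (H y) ?(H x) ?ax ?yb ?(le_trans ax xy) ?(le_trans xy yb)//.
rewrite (@Rintegral_itv_split a x y)//; last exact: integrable_subitv hg.
ring.
Qed.

Lemma ac_increment_le x y : a <= x -> x <= y -> y <= b ->
  `|f y - f x| <= \int[mu]_(t in `[x, y]) `|g t|.
Proof.
move=> ax xy yb; rewrite ac_increment//; apply: le_normr_Rintegral => //.
exact: integrable_subitv fg.1.
Qed.

Lemma ac_unif_continuous : forall e : R, 0 < e -> exists2 d : R, 0 < d &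
  forall x y, a <= x <= b -> a <= y <= b -> `|y - x| < d -> `|f y - f x| <= e.
Proof.
move=> e e0; have [d d0 H] := Rintegral_small fg.1 e0.
exists d => // x y /andP[ax xb] /andP[ay yb].
have [xy|/ltW yx] := leP x y.
  by rewrite ger0_norm ?subr_ge0// => yxd; rewrite (le_trans (ac_increment_le _ _ _))// H.
rewrite ler0_norm ?subr_le0// opprB => yxd.
by rewrite distrC (le_trans (ac_increment_le _ _ _))// H.
Qed.

Lemma ac_continuous : {within `[a, b], continuous f}.
Proof.
apply/subspace_continuousP => x; rewrite /= in_itv/= => xab.
apply/cvgrPdist_le => e e0; have [d d0 H] := ac_unif_continuous e0.
rewrite near_withinE; near=> y => yab; apply: H => //.
Unshelve. all: by end_near. Qed.

Lemma ac_measurable : measurable_fun `[a, b] f.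
Proof. by apply: subspace_continuous_measurable_fun => //; exact: ac_continuous. Qed.

Lemma ac_bounded : exists M : R, forall x, a <= x <= b -> `|f x| <= M.
Proof.
exists (`|f a| + \int[mu]_(t in `[a, b]) `|g t|) => x /andP[ax xb].
have h1 : \int[mu]_(t in `[a, x]) `|g t| <= \int[mu]_(t in `[a, b]) `|g t|.
  apply: Rintegral_subset => //; first by apply: subset_itv; rewrite bnd_simp.
  by apply: integrable_norm; exact: fg.1.
have h2 := ac_increment_le (lexx a) ax xb.
by rewrite -[f x](subrK (f a)) (le_trans (ler_normD _ _))// addrC lerD2l (le_trans h2).
Qed.

End absolutely_continuous.

Section integration_by_parts.
Variables (a b : R) (f g P z : R -> R).
Hypotheses (ab : a <= b) (fg : ac_deriv a b f g) (Pz : ac_deriv a b P z).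
Hypotheses (Pa : P a = 0) (Pb : P b = 0).

Let k (p : measurableTypeR R * measurableTypeR R) : R :=
  g p.1 * z p.2 * (if p.2 <= p.1 then 1 else 0).

Let mR : measurable (`[a, b] : set (measurableTypeR R)).
Proof. exact: measurable_itv. Qed.

Let mk : measurable_fun ((`[a, b] : set (measurableTypeR R)) `*` (`[a, b] : set (measurableTypeR R))) k.
Proof.
apply: measurable_funM.
  apply: measurable_funM.
    apply: (measurable_fun_fst mR (f := g)).
    exact: measurable_integrable fg.1.
  apply: (measurable_fun_snd mR (f := z)).
  exact: measurable_integrable Pz.1.
apply: measurable_funTS.
apply: measurable_fun_ifT => //.
by apply: measurable_fun_ler.
Qed.

Let ik : (mu \x mu)%E.-integrable
  ((`[a, b] : set (measurableTypeR R)) `*` (`[a, b] : set (measurableTypeR R))) (EFin \o k).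
Proof.
have := integrable_prod mR mR (integrable_norm fg.1) (integrable_norm Pz.1).
apply: dominated_integrable => //; first exact: measurableX.
move=> p _; rewrite /k !normrM; case: ifP => _; rewrite ?normr1 ?normr0 ?mulr1//.
by rewrite mulr0 /= mulr_ge0.
Qed.

Let sectionE (x : R) (h : R -> R) (c : R) (lt : R -> R -> bool)  (S : set R) :
  S = `[a, b]%classic `&` [set y | lt y x] -> measurable S ->
  mu.-integrable S (EFin \o h) ->
  \int[mu]_(y in `[a, b]) (c * h y * (if lt y x then 1 else 0)) =
  c * \int[mu]_(y in S) h y.
Proof.
move=> SE mS hS; rewrite -RintegralZl// SE Rintegral_mkcondr.
apply: eq_Rintegral => y _; rewrite patchE /=.
case: ifPn => [yx|yx]; first by rewrite mem_set// mulr1.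
by rewrite memNset ?mulr0//; apply/negP.
Qed.

(** Fubini's theorem for [g x * z y] on the triangle [y <= x]. *)
Lemma ac_integration_by_parts :
  \int[mu]_(x in `[a, b]) (P x * g x) = - \int[mu]_(x in `[a, b]) (z x * f x).
Proof.
have [M fM] := ac_bounded fg.
have izf : mu.-integrable `[a, b] (EFin \o (fun x => z x * f x)).
  apply: (@dominated_integrable _ _ _ mu _ _ (fun x => M * `|z x|)) => //.
  - apply: measurable_funM; last exact: ac_measurable fg.
    exact: measurable_integrable Pz.1.
  - move=> x; rewrite /= in_itv/= => xab.
    by rewrite normrM mulrC ler_wpM2r// fM.
  - by apply: integrableZ_R => //; apply: integrable_norm; exact: Pz.1.
have inL x : a <= x <= b -> `[a, x]%classic = `[a, b]%classic `&` [set y | y <= x].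
  move=> /andP[ax xb]; apply/seteqP; split => y /=; rewrite !in_itv/=.
    by move=> /andP[-> yx]; rewrite (le_trans yx).
  by move=> [/andP[-> _] ->].
have inR y : a <= y <= b -> `[y, b]%classic = `[a, b]%classic `&` [set x | y <= x].
  move=> /andP[ay yb]; apply/seteqP; split => x /=; rewrite !in_itv/=.
    by move=> /andP[yx ->]; rewrite (le_trans ay).
  by move=> [/andP[_ ->] ->].
have LE : \int[mu]_(x in `[a, b]) \int[mu]_(y in `[a, b]) k (x, y) =
    \int[mu]_(x in `[a, b]) (P x * g x).
  apply: eq_Rintegral => x /set_mem/=; rewrite in_itv/= => xab.
  rewrite /k /= (@sectionE x z (g x) (fun y x => y <= x) `[a, x]%classic)//.
  - have /andP[ax xb] := xab.
    by rewrite -(ac_increment Pz (lexx a) ax xb) Pa subr0 mulrC.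
  - exact: inL.
  - by have /andP[ax xb] := xab; apply: integrable_subitv Pz.1.
have RE : \int[mu]_(y in `[a, b]) \int[mu]_(x in `[a, b]) k (x, y) =
    \int[mu]_(y in `[a, b]) (f b * z y - z y * f y).
  apply: eq_Rintegral => y /set_mem/=; rewrite in_itv/= => yab.
  rewrite /k /=; under eq_Rintegral => x _ do rewrite (mulrC (g x)).
  rewrite (@sectionE y g (z y) (fun x y => y <= x) `[y, b]%classic)//.
  - have /andP[ay yb] := yab.
    by rewrite -(ac_increment fg ay yb (lexx b)); ring.
  - exact: inR.
  - by have /andP[ay yb] := yab; apply: integrable_subitv fg.1.
rewrite -LE (Rintegral_Fubini mR mR ik) RE RintegralB//; last first.
  by apply: integrableZ_R => //; exact: Pz.1.
rewrite RintegralZl//; last exact: Pz.1.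
by rewrite -(ac_increment Pz (lexx a) ab (lexx b)) Pa Pb subrr mulr0 sub0r.
Qed.

End integration_by_parts.
End interval_integrals.

(** * The energy density and its subgradients *)

Section energy_density.
Context {R : realType}.
Notation mu := (@lebesgue_measure R).
Implicit Types (a b n p eps : R) (f g w q : R -> R).

Definition energy_density n p eps w g (x : R) : R :=
  eps `^ (p - 1) * `|g x| `^ p / p + potential n (w x) / eps.

Lemma energy_density_ge0 n p eps w g x : 0 < n -> 0 < p -> 0 < eps -> 0 <= energy_density n p eps w g x.
Proof.
move=> n0 p0 e0; rewrite addr_ge0 ?mulr_ge0 ?powR_ge0 ?invr_ge0 ?(ltW p0) ?(ltW e0)//.
by rewrite mulr_ge0// ltW.
Qed.

Lemma measurable_potential n (D : set R) w : 1 < n -> measurable_fun D w ->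
  measurable_fun D (fun x => potential n (w x)).
Proof.
move=> n1 mw.
exact: (measurableT_comp (continuous_measurable_fun (continuous_potential n1)) mw).
Qed.

Lemma measurable_normr_powR p (D : set R) g : measurable_fun D g ->
  measurable_fun D (fun x => `|g x| `^ p).
Proof.
move=> mg; have h : measurable_fun D (fun x => `|g x|) by exact: measurableT_comp.
exact: (measurableT_comp (measurable_powR p) h).
Qed.

Lemma measurable_energy_density n p eps (D : set R) w g : 1 < n ->
  measurable_fun D w -> measurable_fun D g -> measurable_fun D (energy_density n p eps w g).
Proof.
move=> n1 mw mg; apply: measurable_funD.
  apply: measurable_funM => //; apply: measurable_funM => //.
  exact: measurable_normr_powR.
by apply: measurable_funM => //; exact: measurable_potential.
Qed.

Lemma ac_derivB a b f1 g1 f2 g2 : ac_deriv a b f1 g1 -> ac_deriv a b f2 g2 ->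
  ac_deriv a b (fun x => f1 x - f2 x) (fun x => g1 x - g2 x).
Proof.
move=> [i1 h1] [i2 h2]; split; first exact: integrableB_R.
move=> x /andP[ax xb]; rewrite h1 ?ax// h2 ?ax//.
rewrite RintegralB//; [ring|exact: integrable_subitv i1|exact: integrable_subitv i2].
Qed.

Lemma ae_itv (P : R -> Prop) a b : {ae mu, forall x, a <= x <= b -> P x} ->
  {ae mu, forall x, `[a, b]%classic x -> P x}.
Proof. by apply: filterS => x + /=; rewrite in_itv. Qed.

Section subdifferential.
Variables (n p a b eps : R) (U q z ut : R -> R).
Hypotheses (hp : 1 < p) (hnp : p < n) (hab : a < b) (heps : 0 < eps).
Hypotheses (hU : L2 mu `[a, b] U) (hut : L2 mu `[a, b] ut).
Hypotheses (hq : weak_deriv a b U q) (hz : ac_deriv a b (fun x => pflux p (q x)) z).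
Hypotheses (hqa : q a = 0) (hqb : q b = 0).
Hypothesis heq : {ae mu, forall x, a <= x <= b ->
  ut x = eps `^ p * z x - derive1 (potential n) (U x)}.

Let p0 : 0 < p. Proof. exact: lt_trans hp. Qed.
Let n1 : 1 < n. Proof. exact: lt_trans hnp. Qed.
Let n0 : 0 < n. Proof. exact: lt_trans n1. Qed.

(** The flux is absolutely continuous, hence bounded, and so is [q]; thus the
    energy is finite at any time at which the equation holds. *)
Lemma subdifferential_integrable : mu.-integrable `[a, b] (EFin \o energy_density n p eps U q).
Proof.
have [U1 U1q UU1] := hq.
have [M qM] := ac_bounded hz.
have [L UL] := ac_bounded U1q.
have mq := measurable_integrable U1q.1.
have mU1 := ac_measurable U1q.
have mU : measurable_fun `[a, b] U by case: hU.
apply: (@ae_eq_integrable _ _ _ mu _ (energy_density n p eps U1 q)) => //.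
- exact: measurable_energy_density.
- apply: filterS (ae_itv UU1) => x /= UU1x abx.
  by rewrite /energy_density UU1x.
- pose K := M `^ (p / (p - 1)).
  apply: (@bounded_integrable_itv _ _ _ _
      (eps `^ (p - 1) * K / p + (2 * n)^-1 * (1 + L ^+ 2) `^ n / eps)).
    exact: measurable_energy_density.
  move=> x xab; rewrite ger0_norm ?energy_density_ge0// lerD//.
    rewrite ler_wpM2r ?invr_ge0 ?(ltW p0)// ler_wpM2l ?powR_ge0//.
    have := qM x xab; rewrite normr_pflux// => qxM.
    rewrite (_ : `|q x| `^ p = (`|q x| `^ (p - 1)) `^ (p / (p - 1))); last first.
      by rewrite -powRrM; congr (_ `^ _); field; rewrite subr_eq0 gt_eqF.
    rewrite ge0_ler_powR ?nnegrE ?powR_ge0//; first by rewrite divr_ge0 ?subr_ge0 ?(ltW p0) ?(ltW hp).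
    by rewrite (le_trans _ qxM)// powR_ge0.
  rewrite ler_wpM2r ?invr_ge0 ?(ltW heps)// ler_wpM2l ?invr_ge0 ?mulr_ge0 ?(ltW n0)//.
  rewrite ge0_ler_powR ?nnegrE ?(ltW n0)//; first by rewrite addr_ge0 ?sqr_ge0.
  rewrite (le_trans (ler_normB _ _))// normr1 lerD2l normrX.
  by rewrite lerXn2r ?nnegrE//; [exact: le_trans (UL x xab)|exact: UL].
Qed.

(** The equation makes [- eps^-1 ut] a subgradient of the energy: add the tangent
    inequalities of the two terms of the density and integrate by parts; the
    flux vanishes at both ends by the Neumann condition. *)
Lemma subdifferential_le (W G : R -> R) : L2 mu `[a, b] W -> weak_deriv a b W G ->
  ((\int[mu]_(x in `[a, b]) energy_density n p eps U q x
     - eps^-1 * ip mu `[a, b] ut (fun x => W x - U x)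
     - (2 * eps)^-1 * ip mu `[a, b] (fun x => W x - U x) (fun x => W x - U x))%:E
   <= \int[mu]_(x in `[a, b]) (energy_density n p eps W G x)%:E)%E.
Proof.
move=> hW hG; have [W1 W1G WW1] := hG; have [U1 U1q UU1] := hq.
have [->|intoo] := eqVneq (\int[mu]_(x in `[a, b]) (energy_density n p eps W G x)%:E)%E +oo%E.
  by rewrite leey.
have mW : measurable_fun `[a, b] W by case: hW.
have mU : measurable_fun `[a, b] U by case: hU.
have mut : measurable_fun `[a, b] ut by case: hut.
have mG := measurable_integrable W1G.1.
have mq := measurable_integrable U1q.1.
have iWG : mu.-integrable `[a, b] (EFin \o energy_density n p eps W G).
  apply/integrableP; split; first by apply/measurable_EFinP; exact: measurable_energy_density.
  under eq_integral do rewrite /= ger0_norm ?energy_density_ge0//.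
  by rewrite ltey.
have iUq := subdifferential_integrable.
have hWU : L2 mu `[a, b] (fun x => W x - U x) by exact: L2B.
have WU1 := ac_derivB W1G U1q.
have [M WU1M] := ac_bounded WU1.
have [Q qQ] := ac_bounded hz.
have i1 : mu.-integrable `[a, b] (EFin \o (fun x => pflux p (q x) * (G x - q x))).
  apply: (@dominated_integrable _ _ _ mu _ _ (fun x => Q * `|G x - q x|)) => //.
  - apply: measurable_funM; first exact: ac_measurable hz.
    exact: measurable_funB.
  - by move=> x; rewrite /= in_itv/= => xab; rewrite normrM ler_wpM2r// qQ.
  - by apply: integrableZ_R => //; apply: integrable_norm; exact: WU1.1.
have i2 : mu.-integrable `[a, b] (EFin \o (fun x => z x * (W1 x - U1 x))).
  apply: (@dominated_integrable _ _ _ mu _ _ (fun x => M * `|z x|)) => //.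
  - apply: measurable_funM; last exact: ac_measurable WU1.
    exact: measurable_integrable hz.1.
  - by move=> x; rewrite /= in_itv/= => xab; rewrite normrM mulrC ler_wpM2r// WU1M.
  - by apply: integrableZ_R => //; apply: integrable_norm; exact: hz.1.
have mD : measurable (`[a, b]%classic : set (measurableTypeR R)) by exact: measurable_itv.
have i3 := L2_integrableM mD hut hWU.
have i4 := L2_integrableM mD hWU hWU.
rewrite -[leRHS]fine_Rintegral// lee_fin.
(* the tangents of the two convex terms, after the equation has been used to
   replace the derivative of the potential *)
pose L x := energy_density n p eps U q x + eps `^ (p - 1) * (pflux p (q x) * (G x - q x))
  + eps `^ (p - 1) * (z x * (W1 x - U1 x)) - eps^-1 * (ut x * (W x - U x))
  - (2 * eps)^-1 * ((W x - U x) * (W x - U x)).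
have iL1 : mu.-integrable `[a, b] (EFin \o (fun x => energy_density n p eps U q x + eps `^ (p - 1) * (pflux p (q x) * (G x - q x)))).
  by apply: integrableD_R => //; exact: integrableZ_R.
have iL2 : mu.-integrable `[a, b] (EFin \o (fun x => energy_density n p eps U q x + eps `^ (p - 1) * (pflux p (q x) * (G x - q x))
  + eps `^ (p - 1) * (z x * (W1 x - U1 x)))).
  by apply: integrableD_R => //; exact: integrableZ_R.
have iL3 : mu.-integrable `[a, b] (EFin \o (fun x => energy_density n p eps U q x + eps `^ (p - 1) * (pflux p (q x) * (G x - q x))
  + eps `^ (p - 1) * (z x * (W1 x - U1 x)) - eps^-1 * (ut x * (W x - U x)))).
  by apply: integrableB_R => //; exact: integrableZ_R.
have iL : mu.-integrable `[a, b] (EFin \o L).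
  by apply: integrableB_R => //; exact: integrableZ_R.
have <- : \int[mu]_(x in `[a, b]) L x =
    \int[mu]_(x in `[a, b]) energy_density n p eps U q x
     - eps^-1 * ip mu `[a, b] ut (fun x => W x - U x)
     - (2 * eps)^-1 * ip mu `[a, b] (fun x => W x - U x) (fun x => W x - U x).
  rewrite /L RintegralB//; last exact: integrableZ_R.
  rewrite RintegralB//; last exact: integrableZ_R.
  rewrite RintegralD//; last exact: integrableZ_R.
  rewrite RintegralD//; last exact: integrableZ_R.
  rewrite !RintegralZl//.
  rewrite (ac_integration_by_parts (ltW hab) WU1 hz) ?hqa ?hqb ?pflux0//.
  by rewrite mulrN subrK.
apply: ae_le_Rintegral => //.
apply: filterS3 (ae_itv heq) (ae_itv WW1) (ae_itv UU1) => x /= hx hW1 hU1 xab.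
rewrite /L -hW1// -hU1// hx//.
have := powR_tangent (q x) (G x) hp; have := potential_tangent (U x) (W x) n1.
rewrite /energy_density -(mulr_powRB1 (ltW heps) p0).
move: (derive1 _ _) (potential _ _) (potential _ _) => F' FU FW.
have e0 : 0 < eps `^ (p - 1) by rewrite powR_gt0.
have ei : 0 < eps^-1 by rewrite invr_gt0.
move: (eps `^ (p - 1)) e0 => E E0 /(ler_wpM2l (ltW ei)) h1 /(ler_wpM2l (ltW E0)) h2.
have h3 := lerD h2 h1.
apply: (le_trans _ (le_trans h3 _)); rewrite le_eqVlt; apply/orP; left; apply/eqP.
  by field; rewrite ?gt_eqF.
by field; rewrite ?gt_eqF.
Qed.

End subdifferential.
End energy_density.

(** * Paths of square-integrable functions *)

(** Paths of class W^{1,2}_loc((0, oo); L2(a, b)) with derivative [ut], continuous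
    at time 0. *)
Record L2_path (R : realType) (a b : R) (u ut : R -> R -> R) : Prop := {
  path_L2 : forall t : R, 0 <= t ->
    L2 (@lebesgue_measure R) (`[a, b]%classic : set (measurableTypeR R)) (u t) ;
  path_cvg0 : L2norm (@lebesgue_measure R) (`[a, b]%classic : set (measurableTypeR R))
    (fun x => u t x - u 0 x) @[t --> 0^'+] --> (0 : R) ;
  path_measurable : measurable_fun ((`]0, +oo[ : set (measurableTypeR R)) `*`
      (`[a, b] : set (measurableTypeR R)))
    (fun z : measurableTypeR R * measurableTypeR R => ut z.1 z.2 : measurableTypeR R) ;
  path_integrable : forall s t : R, 0 < s -> s < t ->
    (@lebesgue_measure R \x @lebesgue_measure R)%E.-integrable
      ((`[s, t] : set (measurableTypeR R)) `*` (`[a, b] : set (measurableTypeR R)))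
      (fun z : measurableTypeR R * measurableTypeR R => (ut z.1 z.2 ^+ 2)%:E) ;
  path_increment : forall s t : R, 0 < s -> s < t ->
    {ae @lebesgue_measure R, forall x, a <= x <= b ->
       u t x - u s x = \int[@lebesgue_measure R]_(r in `[s, t]) ut r x} }.

Section flow.
Context {R : realType}.
Notation mu := (@lebesgue_measure R).
Notation M := (measurableTypeR R).
Variables (a b : R) (u ut : R -> R -> R).
Notation D := (`[a, b]%classic : set M).
Notation ip := (ip mu D).
Notation L2 := (L2 mu D).
Notation N := (L2norm mu D).
Implicit Types r s t : R.
Hypothesis hP : L2_path a b u ut.
Let hu := path_L2 hP.
Let hu0 := path_cvg0 hP.
Let mut := path_measurable hP.
Let iut := path_integrable hP.
Let hut := path_increment hP.

Let mD : measurable D. Proof. exact: measurable_itv. Qed.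
Let mI s t : measurable (`[s, t]%classic : set M). Proof. exact: measurable_itv. Qed.

Definition kinetic s t : R := \int[mu]_(r in `[s, t]) ip (ut r) (ut r).

Let mut_sub s t : 0 < s ->
  measurable_fun ((`[s, t] : set M) `*` D) (fun z : M * M => ut z.1 z.2).
Proof.
move=> s0; apply: measurable_funS mut; first exact: measurableX.
move=> [r x] [/= ri xD]; split => //=; move: ri; rewrite !in_itv/= andbT => /andP[sr _].
exact: lt_le_trans sr.
Qed.

Let iut1 s t : 0 < s -> s < t ->
  (mu \x mu)%E.-integrable ((`[s, t] : set M) `*` D) (EFin \o (fun z : M * M => ut z.1 z.2 * ut z.1 z.2)).
Proof. exact: iut. Qed.

Let iutf s t f : 0 < s -> s < t -> L2 f ->
  (mu \x mu)%E.-integrable ((`[s, t] : set M) `*` D) (EFin \o (fun z : M * M => ut z.1 z.2 * f z.2)).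
Proof.
move=> s0 st hf; have [mf f2] := hf.
have := integrable_prod (mI s t) mD (integrable_itv_cst s t 1) f2 => h.
have h2 := integrableD_R (measurableX (mI s t) mD) (iut1 s0 st) h.
apply: dominated_integrable h2; first exact: measurableX.
  by apply: measurable_funM; [exact: mut_sub|exact: measurable_fun_snd].
move=> [r x] _ /=; rewrite normrM mul1r.
have := sqr_ge0 (`|ut r x| - `|f x|).
rewrite -(real_normK (num_real (f x))) -expr2 -(real_normK (num_real (ut r x))).
have : 0 <= `|ut r x| by []. have : 0 <= `|f x| by [].
by move: `|ut r x| `|f x| => A B A0 B0; rewrite !expr2; nra.
Qed.

(** The exceptional sets in [path_increment] depend on the times; pairing with a
    fixed function removes them. *)
Lemma flow_Fubini s t f : 0 < s -> s < t -> L2 f ->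
  mu.-integrable `[s, t] (EFin \o (fun r => ip (ut r) f)) /\
  \int[mu]_(r in `[s, t]) ip (ut r) f = ip (fun x => u t x - u s x) f.
Proof.
move=> s0 st hf; have [mf f2] := hf.
have i1 := iutf s0 st hf.
split; first exact: (integrable_slice1 (mI s t) mD i1).
rewrite {1}/ip (Rintegral_Fubini (mI s t) mD i1) /=.
have L1 : L2 (fun=> 1 : R).
  split; first exact: measurable_cst.
  exact: integrable_itv_cst.
have i2 := iutf s0 st L1.
have [mt _] := hu (ltW (lt_trans s0 st)); have [ms _] := hu (ltW s0).
apply: (@ae_eq_Rintegral _ _ _ mu) => //.
- have := measurable_integrable (integrable_slice2 (mI s t) mD i1); exact.
- by apply: measurable_funM => //; exact: measurable_funB.
have h := ae_integrable_slice2 (mI s t) mD i2.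
have h' := hut s0 st.
apply: filterS2 h h' => x /= h h' xD.
rewrite RintegralZr//.
  by rewrite h'//; move: xD; rewrite in_itv.
have := h xD.
by under [X in EFin \o X]eq_fun do rewrite mulr1.
Qed.

Lemma flow_test s t f c B : 0 < s -> s < t -> L2 f ->
  {ae mu, forall r, s <= r <= t -> ip (ut r) f - c * ip (ut r) (ut r) <= B} ->
  ip (fun x => u t x - u s x) f - c * kinetic s t <= (t - s) * B.
Proof.
move=> s0 st hf hB.
have [i1 <-] := flow_Fubini s0 st hf.
have i2 : mu.-integrable `[s, t] (EFin \o (fun r => ip (ut r) (ut r))).
  exact: (integrable_slice1 (mI s t) mD (iut1 s0 st)).
rewrite /kinetic -RintegralZl// -RintegralB//; last exact: integrableZ_R.
rewrite mulrC -Rintegral_itv_cst; last exact: ltW.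
apply: ae_le_Rintegral => //.
- exact: (integrableB_R (mI s t) i1 (integrableZ_R c (mI s t) i2)).
- exact: integrable_itv_cst.
Qed.

Lemma flow_L2_ut s t : 0 < s -> s < t -> {ae mu, forall r, s <= r <= t -> L2 (ut r)}.
Proof.
move=> s0 st; have := ae_integrable_slice1 (mI s t) mD (iut s0 st).
apply: filterS => r /= h rst; split.
  have r0 : 0 < r by case/andP: rst => sr _; apply: lt_le_trans sr.
  apply: (@measurable_comp _ _ _ _ _ _ ((`]0, +oo[ : set M) `*` D)
    (fun z : M * M => ut z.1 z.2) D (fun x => (r, x))).
  - exact: measurableX.
  - by move=> _ [x xD <-]; split => //=; rewrite in_itv/= r0.
  - exact: mut.
  - exact/measurable_funTS/pair1_measurable.
by apply: h; rewrite in_itv.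
Qed.

Lemma kinetic_ge0 s t : 0 <= kinetic s t.
Proof. by apply: Rintegral_ge0 => r _; exact: ip_ge0. Qed.

Lemma kinetic_split r s t : 0 < r -> r <= s -> s <= t -> r < t -> kinetic r t = kinetic r s + kinetic s t.
Proof.
move=> r0 rs st rt; apply: Rintegral_itv_split => //.
exact: (integrable_slice1 (mI r t) mD (iut1 r0 rt)).
Qed.

(** This is [flow_test] for the increment itself and Young's inequality. *)
Lemma flow_increment s t : 0 < s -> s < t ->
  ip (fun x => u t x - u s x) (fun x => u t x - u s x) <= (t - s) * kinetic s t.
Proof.
move=> s0 st; have ts : 0 < t - s by rewrite subr_gt0.
have alg (X T G : R) : X - T / 2 * G <= X / 2 -> X <= T * G by lra.
pose f x := u t x - u s x.
have hf : L2 f by apply: (L2B mD); apply: hu; rewrite ltW// (lt_trans s0).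
rewrite -/f.
have := @flow_test s t f ((t - s) / 2) (ip f f / (2 * (t - s))) s0 st hf.
have -> : (t - s) * (ip f f / (2 * (t - s))) = ip f f / 2.
  by field; rewrite gt_eqF.
move=> H; apply: alg; apply: H; apply: filterS (flow_L2_ut s0 st) => r hr rst.
rewrite lerBlDl; apply: (ip_young mD ts (hr rst) hf).
Qed.

Let sub_L2 s t : 0 <= s -> 0 <= t -> L2 (fun x => u s x - u t x).
Proof. by move=> s0 t0; apply: (L2B mD); exact: hu. Qed.

(** At time 0 this is [path_cvg0]; at positive times [flow_increment] gives Hoelder
    continuity. *)
Lemma flow_continuous t : 0 <= t ->
  N (fun x => u s x - u t x) @[s --> within [set s : R | 0 <= s] (nbhs t)] --> (0 : R).
Proof.
rewrite le_eqVlt => /predU1P[<-|t0].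
  apply/cvgrPdist_le => e e0; rewrite near_withinE.
  have /cvgrPdist_le/(_ e e0) := hu0; rewrite near_withinE.
  apply: filterS => s h; rewrite /= le_eqVlt => /predU1P[<-|]; last exact: h.
  rewrite /N (_ : ip _ _ = 0) ?sqrtr0 ?subrr ?normr0 ?ltW//.
  rewrite /ip /Rintegral; under eq_integral do rewrite subrr mul0r.
  by rewrite integral0.
apply/cvgrPdist_le => e e0; rewrite near_withinE.
pose G := kinetic (t / 2) (t + 1).
have G0 : 0 <= G by exact: kinetic_ge0.
have t2 : 0 < t / 2 by rewrite divr_gt0.
near=> s => s0; rewrite sub0r normrN ger0_norm ?sqrtr_ge0//.
have ts : t / 2 < s.
  by near: s; apply: lt_nbhsr; rewrite ltr_pdivrMr// mulr_natr mulr2n ltrDl.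
have st1 : s < t + 1 by near: s; apply: lt_nbhsl; rewrite ltrDl.
have H r r' : t / 2 < r -> r < r' -> r' < t + 1 ->
    N (fun x => u r' x - u r x) ^+ 2 <= (r' - r) * G.
  move=> r1 r2 r3; have rp : 0 < r by exact: lt_trans r1.
  rewrite sqr_sqrtr ?ip_ge0// (le_trans (flow_increment rp r2))//.
  rewrite ler_wpM2l ?subr_ge0 ?(ltW r2)//.
  rewrite /G (kinetic_split t2 (ltW r1)) ?(ltW (lt_trans r2 r3)) ?(lt_trans r1 (lt_trans r2 r3))//.
  rewrite (kinetic_split rp (ltW r2) (ltW r3) (lt_trans r2 r3)).
  by have := kinetic_ge0 (t / 2) r; have := kinetic_ge0 r' (t + 1); lra.
have H2 : N (fun x => u s x - u t x) ^+ 2 <= `|s - t| * G.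
  have [st|ts'|->] := ltgtP s t.
  - rewrite (L2norm_distC mu D) distrC ger0_norm ?subr_ge0 ?(ltW st)//.
    by apply: H => //; rewrite ltrDl.
  - rewrite ger0_norm ?subr_ge0 ?(ltW ts')//; apply: H => //.
    by rewrite ltr_pdivrMr// mulr_natr mulr2n ltrDl.
  - rewrite subrr normr0 mul0r sqr_sqrtr ?ip_ge0//.
    rewrite /ip /Rintegral; under eq_integral do rewrite subrr mul0r.
    by rewrite integral0.
rewrite -(@ler_pXn2r _ 2) ?nnegrE ?sqrtr_ge0 ?(ltW e0)//.
rewrite (le_trans H2)// (@le_trans _ _ (`|s - t| * (G + 1)))//.
  by rewrite ler_wpM2l// lerDl.
rewrite -ler_pdivlMr ?ltr_wpDl//.
rewrite distrC; near: s; apply: cvgr_dist_le => //.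
by rewrite divr_gt0 ?exprn_gt0 ?ltr_wpDl.
Unshelve. all: by end_near. Qed.

Lemma flow_dist_continuous (w : R -> R) t : L2 w -> 0 <= t ->
  N (fun x => u s x - w x) @[s --> within [set s : R | 0 <= s] (nbhs t)] -->
  N (fun x => u t x - w x).
Proof.
move=> hw t0; apply/cvgrPdist_le => e e0.
have := flow_continuous t0 => /cvgrPdist_le/(_ e e0).
rewrite !near_withinE; apply: filterS => s h s0; apply: le_trans (h s0).
rewrite sub0r normrN [X in _ <= X]ger0_norm ?sqrtr_ge0//.
by rewrite (L2norm_distC mu D (u s) (u t)); exact: (L2norm_lip mD (hu t0) (hu s0) hw).
Qed.

Lemma flow_ip_continuous (f w : R -> R) t : L2 f -> L2 w -> 0 <= t ->
  ip f (fun x => u s x - w x) @[s --> within [set s : R | 0 <= s] (nbhs t)] -->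
  ip f (fun x => u t x - w x).
Proof.
move=> hf hw t0; apply/cvgrPdist_le => e e0.
have F0 : 0 < N f + 1 by rewrite ltr_wpDl ?sqrtr_ge0.
have eF : 0 < e / (N f + 1) by rewrite divr_gt0.
have /cvgrPdist_le/(_ _ eF) := flow_continuous t0.
rewrite !near_withinE; apply: filterS => s h s0.
have := h s0; rewrite sub0r normrN [X in X <= _ -> _]ger0_norm ?sqrtr_ge0// => {}h.
rewrite -(ipB mD hf (L2B mD (hu t0) hw) (L2B mD (hu s0) hw)).
rewrite (_ : (fun x => _) = (fun x => u t x - u s x)); last first.
  by apply/funext => x; ring.
rewrite (le_trans (cauchy_schwarz mD hf (sub_L2 t0 s0)))//.
rewrite (L2norm_distC mu D).
apply: (@le_trans _ _ ((N f + 1) * (e / (N f + 1)))).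
  by rewrite ler_pM ?sqrtr_ge0// lerDl.
by rewrite mulrC divfK// gt_eqF.
Qed.

(** The hypothesis says that half of the squared distance [y] to the state at
    time [s] satisfies [y' <= K + y] almost everywhere. On a step [[r, r']] the
    flow is tested against [u r - u s], which does not depend on time, and
    replacing it by the current difference costs terms of second order in the
    step, as [gronwall_increments] allows. *)
Lemma flow_gronwall s t (K : R) : 0 <= s -> s < t -> 0 <= K ->
  {ae mu, forall r, s < r <= t ->
    ip (ut r) (fun x => u r x - u s x) <=
    K + ip (fun x => u r x - u s x) (fun x => u r x - u s x) / 2} ->
  ip (fun x => u t x - u s x) (fun x => u t x - u s x) / 2 <= (expR (2 * (t - s)) - 1) * K.
Proof.
move=> s0 st K0 hK.
have alg1 (I1 I2 g yq Y Z G T : R) : I1 <= K + yq -> yq <= Y ->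
    I2 <= T / 2 * g + Z -> Z <= G / 2 -> I1 + I2 - T / 2 * g <= K + Y + G / 2 by lra.
have alg2 (X Y Z G T : R) : 0 <= T * G -> X - T / 2 * G <= T * (K + Y + G / 2) ->
    Z <= T * G -> X + Z / 2 <= T * (K + Y + 2 * G) by lra.
have alg3 (E Y : R) : Y + K <= E * K -> Y <= (E - 1) * K by lra.
pose y r := ip (fun x => u r x - u s x) (fun x => u r x - u s x) / 2.
have yN r : y r = N (fun x => u r x - u s x) ^+ 2 / 2 by rewrite sqr_sqrtr ?ip_ge0.
have y0 r : 0 <= y r by rewrite divr_ge0 ?ip_ge0.
have ycont r : 0 <= r -> y r' @[r' --> within [set s : R | 0 <= s] (nbhs r)] --> y r.
  move=> r0; under eq_fun do rewrite yN; rewrite yN.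
  apply: cvgMl; under eq_fun do rewrite expr2; rewrite expr2.
  by apply: cvgM; apply: flow_dist_continuous => //; exact: hu.
have main s1 : s < s1 < t -> y t + K <= expR (2 * (t - s)) * (y s1 + K).
  move=> /andP[ss1 s1t]; have s10 : 0 < s1 by exact: le_lt_trans ss1.
  apply: (@le_trans _ _ (expR (2 * (t - s1)) * (y s1 + K))); last first.
    by rewrite ler_wpM2r ?addr_ge0// ler_expR; lra.
  apply: (@gronwall_increments _ y (kinetic s1)) => //.
  - exact: ltW.
  - move=> r /andP[s1r rt] e e0; have r0 : 0 <= r by rewrite ltW// (lt_le_trans s10).
    have /cvgrPdist_le/(_ e e0) := ycont r r0; rewrite near_withinE.
    move=> /nbhs_ballP[d d0 H]; exists d => // r' /andP[s1r' _] rd.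
    rewrite distrC; apply: H; last by rewrite /= ltW// (lt_le_trans s10).
    by rewrite /ball/= distrC.
  - move=> r r'; rewrite le_eqVlt => /predU1P[<-|s1r].
      move=> rr' r't; rewrite (_ : kinetic s1 s1 = 0) ?kinetic_ge0// /kinetic set_itv1.
      by rewrite Rintegral_set1.
    move=> rr' r't; rewrite (kinetic_split s10 (ltW s1r) rr') ?(lt_le_trans s1r)//.
    by rewrite lerDl kinetic_ge0.
  - move=> r r' Y s1r rr' r't yY.
    have r0 : 0 < r by exact: lt_le_trans s1r.
    have r'0 : 0 < r' by exact: lt_trans rr'.
    have tau0 : 0 < r' - r by rewrite subr_gt0.
    have -> : kinetic s1 r' - kinetic s1 r = kinetic r r'.
      rewrite (kinetic_split s10 s1r (ltW rr')) ?(le_lt_trans s1r)//; ring.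
    have hr : L2 (u r) by apply: hu; exact: ltW.
    have hs : L2 (u s) by exact: hu.
    have hf := sub_L2 (ltW r0) s0.
    have yE : y r' - y r = ip (fun x => u r' x - u r x) (fun x => u r x - u s x) +
        ip (fun x => u r' x - u r x) (fun x => u r' x - u r x) / 2.
      have E : (fun x => u r' x - u s x) =
          (fun x => (u r x - u s x) + (u r' x - u r x)).
        by apply/funext => x; ring.
      rewrite /y E (ip_sqrD mD hf (sub_L2 (ltW r'0) (ltW r0))).
      by rewrite [ip (fun x => u r' x - u r x) (fun x => u r x - u s x)]ipC; field.
    have inc := flow_increment r0 rr'.
    have : ip (fun x => u r' x - u r x) (fun x => u r x - u s x)
        - (r' - r) / 2 * kinetic r r' <= (r' - r) * (K + Y + kinetic r r' / 2).
      apply: flow_test => //.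
      apply: filterS2 hK (flow_L2_ut r0 rr') => q hKq hutq rqr'.
      have /andP[rq qr'] := rqr'.
      have q0 : 0 <= q by rewrite ltW// (lt_le_trans r0).
      have := hKq; rewrite (lt_le_trans (lt_le_trans ss1 s1r) rq) (le_trans qr' r't).
      move=> /(_ isT); rewrite -/(y q) => h1.
      have := yY q rqr' => h2.
      have E : (fun x => u r x - u s x) = (fun x => (u q x - u s x) + (u r x - u q x)).
        by apply/funext => x; ring.
      rewrite E (ipD mD (hutq rqr') (sub_L2 q0 s0) (sub_L2 (ltW r0) q0)).
      have h3 := ip_young mD tau0 (hutq rqr') (sub_L2 (ltW r0) q0).
      apply: alg1 h1 h2 h3 _.
      rewrite ler_pdivrMr ?mulr_gt0//.
      have -> : kinetic r r' / 2 * (2 * (r' - r)) = (r' - r) * kinetic r r' by field.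
      move: rq; rewrite le_eqVlt => /predU1P[<-|rq].
        have -> : ip (fun x => u r x - u r x) (fun x => u r x - u r x) = 0.
          rewrite /ip /Rintegral; under eq_integral do rewrite subrr mul0r.
          by rewrite integral0.
        by rewrite mulr_ge0 ?kinetic_ge0// ltW.
      have -> : ip (fun x => u r x - u q x) (fun x => u r x - u q x) =
          ip (fun x => u q x - u r x) (fun x => u q x - u r x).
        by apply: eq_Rintegral => x _; ring.
      apply: (le_trans (flow_increment r0 rq)).
      rewrite (kinetic_split r0 (ltW rq) qr' rr') ler_pM ?subr_ge0 ?(ltW rq) ?kinetic_ge0 ?lerD2r//.
      by rewrite lerDl kinetic_ge0.
    move=> H; rewrite yE; apply: alg2 H inc.
    by rewrite mulr_ge0 ?kinetic_ge0 ?(ltW tau0).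
(* let the starting time decrease to s *)
have ys : y s = 0.
  rewrite /y (_ : ip _ _ = 0) ?mul0r// /ip /Rintegral.
  by under eq_integral do rewrite subrr mul0r; rewrite integral0.
apply: alg3; rewrite -/(y t).
apply/ler_addgt0Pr => e e0.
have E0 := expR_gt0 (2 * (t - s)).
have /cvgrPdist_le/(_ (e / expR (2 * (t - s)))) := ycont s s0.
rewrite divr_gt0// => /(_ isT); rewrite near_withinE ys => /nbhs_ballP[d d0 H].
pose s1 := s + Num.min (d / 2) ((t - s) / 2).
have m0 : 0 < Num.min (d / 2) ((t - s) / 2).
  by rewrite lt_min !divr_gt0// subr_gt0.
have m1 : Num.min (d / 2) ((t - s) / 2) <= d / 2 by rewrite ge_min lexx.
have m2 : Num.min (d / 2) ((t - s) / 2) <= (t - s) / 2 by rewrite ge_min lexx orbT.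
have d0' : (0 : R) < d := d0.
have ss1 : s < s1 by rewrite ltrDl.
have s1t : s1 < t by rewrite /s1; lra.
have := main s1; rewrite ss1 s1t => /(_ isT) /le_trans; apply.
rewrite mulrDr addrC lerD2l mulrC -ler_pdivlMr//.
have := H s1; rewrite sub0r normrN ger0_norm//; apply; last by rewrite /= (le_trans s0)// ltW.
by rewrite /ball/= distrC ger0_norm ?subr_ge0 ?(ltW ss1)// /s1; lra.
Qed.

End flow.

(** * Gradient flows of the energy *)

Section L1_distance.
Context {R : realType}.
Notation mu := (@lebesgue_measure R).
Notation M := (measurableTypeR R).
Variables (a b : R).
Notation D := (`[a, b]%classic : set M).
Hypothesis hab : a < b.

Let mD : measurable D. Proof. exact: measurable_itv. Qed.

Definition L1dist (f g : R -> R) : R := \int[mu]_(x in D) `|f x - g x|.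

Lemma L1distC f g : L1dist f g = L1dist g f.
Proof. by apply: eq_Rintegral => x _; rewrite distrC. Qed.

Lemma L1dist_triangle f g h : mu.-integrable D (EFin \o f) -> mu.-integrable D (EFin \o g) ->
  mu.-integrable D (EFin \o h) -> L1dist f h <= L1dist f g + L1dist g h.
Proof.
move=> hf hg hh; rewrite /L1dist -RintegralD//; last 2 first.
- by apply: integrable_norm; exact: integrableB_R.
- by apply: integrable_norm; exact: integrableB_R.
apply: le_Rintegral => //.
- by apply: integrable_norm; exact: integrableB_R.
- by apply: integrableD_R => //; apply: integrable_norm; exact: integrableB_R.
- by move=> x _; exact: ler_distD.
Qed.

Lemma L1dist_ae f f' g : measurable_fun D f -> measurable_fun D f' -> measurable_fun D g ->
  {ae mu, forall x, D x -> f x = f' x} -> L1dist f g = L1dist f' g.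
Proof.
move=> mf mf' mg ff'; apply: (@ae_eq_Rintegral _ _ _ mu D) => //.
- have mfg : measurable_fun D (fun x => f x - g x) by exact: measurable_funB.
  exact: measurableT_comp.
- have mfg : measurable_fun D (fun x => f' x - g x) by exact: measurable_funB.
  exact: measurableT_comp.
by apply: filterS ff' => x h xD; rewrite h.
Qed.

Lemma lebesgue_itv_lty : (mu D < +oo)%E.
Proof. by rewrite lebesgue_measure_itv/=; case: ifP => _; rewrite ltry. Qed.

Lemma L1dist_le_L2norm f g : L2 mu D f -> L2 mu D g ->
  L1dist f g <= Num.sqrt (b - a) * L2norm mu D (fun x => f x - g x).
Proof.
move=> hf hg; have h1 : L2 mu D (fun=> 1 : R).
  by split; [exact: measurable_cst|exact: integrable_itv_cst].
have [mfg ifg] := L2B mD hf hg.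
have h2 : L2 mu D (fun x => `|f x - g x|).
  split; first exact: measurableT_comp.
  by under [X in EFin \o X]eq_fun do rewrite real_normK ?num_real//.
have := cauchy_schwarz mD h1 h2 => /(le_trans (ler_norm _)).
rewrite (_ : ip mu D _ _ = L1dist f g); last first.
  by apply: eq_Rintegral => x _; rewrite mul1r.
rewrite (_ : L2norm mu D (fun=> 1) = Num.sqrt (b - a)); last first.
  congr Num.sqrt; rewrite /ip; under eq_Rintegral do rewrite mulr1.
  by rewrite Rintegral_itv_cst ?mul1r// ltW.
rewrite (_ : L2norm mu D (fun x => `|f x - g x|) = L2norm mu D (fun x => f x - g x))//.
by congr Num.sqrt; apply: eq_Rintegral => x _; rewrite -!expr2 real_normK ?num_real.
Qed.

End L1_distance.

Section gradient_flow.
Context {R : realType}.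
Notation mu := (@lebesgue_measure R).
Notation M := (measurableTypeR R).
Variables (n p a b eps : R) (u ut : R -> R -> R).
Notation D := (`[a, b]%classic : set M).
Notation ip := (ip mu D).
Notation L2 := (L2 mu D).
Notation N := (L2norm mu D).
Implicit Types r s t e : R.
Hypotheses (hp : 1 < p) (hnp : p < n) (hab : a < b) (heps : 0 < eps).
Hypothesis hP : L2_path a b u ut.
Hypothesis heq : {ae mu, forall t : R, 0 < t -> exists q w : R -> R,
  [/\ weak_deriv a b (u t) q, ac_deriv a b (fun x => pflux p (q x)) w,
      q a = 0 /\ q b = 0 &
      {ae mu, forall x, a <= x <= b ->
        ut t x = eps `^ p * w x - derive1 (potential n) (u t x)}]}.

Let mD : measurable D. Proof. exact: measurable_itv. Qed.
Let hu := path_L2 hP.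

(** The energy [E] is a parameter since the weak derivative [q] is determined by
    [u r] only almost everywhere. *)
Definition regular_time r E := [/\ 0 < r, L2 (ut r) & exists q w : R -> R,
  [/\ weak_deriv a b (u r) q, ac_deriv a b (fun x => pflux p (q x)) w,
      q a = 0 /\ q b = 0,
      {ae mu, forall x, a <= x <= b ->
        ut r x = eps `^ p * w x - derive1 (potential n) (u r x)} &
      E = \int[mu]_(x in D) energy_density n p eps (u r) q x]].

(** The quadratic minorant of the energy given by the subgradient at time [r],
    evaluated along the path. *)
Definition minorant r E t : R := E - eps^-1 * ip (ut r) (fun x => u t x - u r x)
  - (2 * eps)^-1 * ip (fun x => u t x - u r x) (fun x => u t x - u r x).

(** The energy at time [t] is at most [e], where the energy is replaced by the
    supremum of the quadratic minorants given by the subgradients along the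
    path. Unlike the energy, this supremum is lower semicontinuous in time by
    construction; both agree at regular times. *)
Definition energy_le t e := forall r E, regular_time r E -> minorant r E t <= e.

(** Square integrability of [ut] on the strips [[1 / k, k]] and a countable union
    of null sets. *)
Lemma ae_regular_time : {ae mu, forall r, 0 < r -> exists E, regular_time r E}.
Proof.
have h : {ae mu, forall r, forall k : nat, k.+1%:R^-1 <= r <= k.+2%:R -> L2 (ut r)}.
  apply: ae_foralln => k; apply: (flow_L2_ut hP); first by rewrite invr_gt0.
  by rewrite (@le_lt_trans _ _ 1) ?invf_le1 ?ler1n// ltr1n.
apply: filterS2 heq h => r hr hk r0; have [q [w [h1 h2 h3 h4]]] := hr r0.
exists (\int[mu]_(x in D) energy_density n p eps (u r) q x); split => //; last by exists q, w.
pose k := maxn (Num.truncn r) (Num.truncn r^-1).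
apply: (hk k).
have k1 : (Num.truncn r <= k)%N by rewrite leq_max leqnn.
have k2 : (Num.truncn r^-1 <= k)%N by rewrite leq_max leqnn orbT.
apply/andP; split.
  rewrite -[leRHS]invrK lef_pV2 ?posrE ?invr_gt0//.
  by rewrite ltW// (lt_le_trans (truncnS_gt _))// ler_nat ltnS.
by rewrite ltW// (lt_le_trans (truncnS_gt _))// ler_nat ltnS ltnW// ltnS.
Qed.

Lemma regular_time_dense s t : 0 <= s -> s < t -> exists r E, s < r < t /\ regular_time r E.
Proof.
move=> s0 st; apply/not_existsP => nE.
have : mu `]s, t[%classic = 0%E.
  have [A [mA A0 hA]] := ae_regular_time.
  apply/eqP; rewrite eq_le measure_ge0 andbT -A0 le_measure ?inE//.
  move=> r /=; rewrite in_itv/= => srt; apply: hA => /= h.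
  have /andP[sr rt] := srt.
  have [E gE] := h (le_lt_trans s0 sr).
  by apply: (nE r); exists E.
by rewrite lebesgue_measure_itv/= lte_fin st -EFinD => -[] /eqP; rewrite subr_eq0 gt_eqF.
Qed.

Lemma energy_le_eq_on (f f' : R -> R) : (forall x, a <= x <= b -> f x = f' x) ->
  (energy n p a b eps f <= energy n p a b eps f')%E.
Proof.
move=> ff'; apply: le_ereal_inf_tmp => _ [q [f1 f1q f'f1] <-].
apply: ereal_inf_lbound; exists q.
  by exists f1 => //; apply: filterS f'f1 => x h xab; rewrite ff'// h.
by apply: eq_integral => x; rewrite inE/= in_itv/= => xab; rewrite ff'.
Qed.

Lemma energy_le_of_energy t e : 0 <= t -> (energy n p a b eps (u t) <= e%:E)%E ->
  energy_le t e.
Proof.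
move=> t0 he r E [r0 hut [q [w [h1 h2 [h3 h4] h5 ->]]]].
rewrite -lee_fin; apply: le_trans he; apply: le_ereal_inf_tmp => _ [G hG <-].
exact: (subdifferential_le hp hnp hab heps (hu (ltW r0)) hut h1 h2 h3 h4 h5 (hu t0) hG).
Qed.

Lemma minorant_self r E : minorant r E r = E.
Proof.
have z f : ip f (fun x => u r x - u r x) = 0.
  by rewrite /ip /Rintegral; under eq_integral do rewrite subrr mulr0; rewrite integral0.
by rewrite /minorant !z !mulr0 !subr0.
Qed.

Lemma regular_energy_le r E : regular_time r E -> energy_le r E.
Proof.
move=> [r0 hut [q [w [h1 h2 [h3 h4] h5 ->]]]].
apply: energy_le_of_energy; first exact: ltW.
rewrite fine_Rintegral//; first by apply: ereal_inf_lbound; exists q.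
exact: (subdifferential_integrable hp hnp heps (hu (ltW r0)) h1 h2).
Qed.

Lemma energy_le_regular r E e : regular_time r E -> energy_le r e -> E <= e.
Proof. by move=> g /(_ _ _ g); rewrite minorant_self. Qed.

Lemma energy_le_trans t e e' : e <= e' -> energy_le t e -> energy_le t e'.
Proof. by move=> ee' h r E g; rewrite (le_trans (h r E g)). Qed.

Lemma minorant_continuous r E t : regular_time r E -> 0 <= t ->
  minorant r E s @[s --> within [set s : R | 0 <= s] (nbhs t)] --> minorant r E t.
Proof.
move=> [r0 hut _] t0; have hr := hu (ltW r0).
apply: cvgB; first apply: cvgB; first exact: cvg_cst.
  by apply: cvgMr; exact: (flow_ip_continuous hP).
apply: cvgMr.
have sqN s : ip (fun x => u s x - u r x) (fun x => u s x - u r x) =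
    N (fun x => u s x - u r x) * N (fun x => u s x - u r x).
  by rewrite -expr2 sqr_sqrtr// ip_ge0.
under eq_fun do rewrite sqN; rewrite sqN.
by apply: cvgM; exact: (flow_dist_continuous hP).
Qed.

Lemma energy_le_closed t e : 0 <= t ->
  (forall d : R, 0 < d -> exists s, [/\ 0 <= s, `|s - t| < d & energy_le s e]) ->
  energy_le t e.
Proof.
move=> t0 h r E g; apply/ler_addgt0Pr => e1 e10.
have /cvgrPdist_le/(_ e1 e10) := minorant_continuous g t0.
rewrite near_withinE => /nbhs_ballP[d d0 H].
have [s [s0 sd hs]] := h d d0.
have := H s; rewrite /ball/= distrC => /(_ sd s0).
move=> /(le_trans (ler_norm _)); rewrite lerBlDl => /le_trans; apply.
by rewrite lerD2r; exact: hs.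
Qed.

(** Otherwise, after the last time at which the energy was at most [e] all
    energies would exceed the energy at this time, so that the path could only move
    away from it against its own gradient; by Gronwall's inequality it does
    not move at all. *)
Lemma energy_le_mono s t e : 0 <= s -> s <= t -> energy_le s e -> energy_le t e.
Proof.
move=> s0 st hs; apply: contrapT => nt.
pose A := [set r : R | s <= r <= t /\ energy_le r e].
have As : A s by split => //; rewrite lexx.
have supA : has_sup A by split; [exists s|exists t => r [/andP[]]].
pose c := sup A.
have sc : s <= c by apply: ub_le_sup As; case: supA.
have ct : c <= t by apply: ge_sup; [exists s|move=> r [/andP[]]].
have c0 : 0 <= c by exact: le_trans sc.
have hc : energy_le c e.
  apply: energy_le_closed => // d d0.
  have [r [/andP[sr rt] hr] cr] := sup_adherent d0 supA.
  exists r; split => //; first exact: le_trans sr.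
  rewrite distrC ger0_norm ?subr_ge0; last by apply: ub_le_sup; [case: supA|split; rewrite ?sr].
  by move: cr; rewrite -/c; lra.
have clt : c < t.
  by rewrite lt_neqAle ct andbT; apply/eqP => ctE; apply: nt; rewrite -ctE.
have nle r : c < r <= t -> ~ energy_le r e.
  move=> /andP[cr rt] hr; have : A r by split => //; rewrite rt andbT (le_trans sc)// ltW.
  by move=> /(ub_le_sup (proj2 supA)); rewrite leNgt cr.
have Nc r : L2norm mu D (fun x => u r x - u c x) ^+ 2 =
    ip (fun x => u r x - u c x) (fun x => u r x - u c x).
  by rewrite sqr_sqrtr// ip_ge0.
have : ip (fun x => u t x - u c x) (fun x => u t x - u c x) / 2 <= (expR (2 * (t - c)) - 1) * 0.
  apply: (flow_gronwall hP) => //.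
  apply: filterS ae_regular_time => r /= gr crt; have /andP[cr rt] := crt.
  have r0 : 0 < r by exact: le_lt_trans cr.
  have [E g] := gr r0.
  have eE : e < E.
    rewrite ltNge; apply/negP => Ee; apply: (nle r crt).
    exact: energy_le_trans Ee (regular_energy_le g).
  have := hc r E g; rewrite /minorant.
  have [_ hut _] := g.
  have -> : ip (ut r) (fun x => u c x - u r x) = - ip (ut r) (fun x => u r x - u c x).
    rewrite -mulN1r -(ipZ mD (-1) hut); last by apply: (L2B mD); apply: hu => //; exact: ltW.
    by congr (ip (ut r) _); apply/funext => x; rewrite mulN1r opprB.
  have -> : ip (fun x => u c x - u r x) (fun x => u c x - u r x) =
      ip (fun x => u r x - u c x) (fun x => u r x - u c x).
    by apply: eq_Rintegral => x _; ring.
  have alg (X Y : R) : E - eps^-1 * - X - (2 * eps)^-1 * Y <= e -> X <= 0 + Y / 2.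
    move=> h; rewrite add0r -subr_ge0 -(pmulr_rge0 _ (_ : 0 < eps^-1)) ?invr_gt0//.
    have -> : eps^-1 * (Y / 2 - X) = (2 * eps)^-1 * Y - eps^-1 * X.
      by field; rewrite gt_eqF.
    by lra.
  exact: alg.
rewrite mulr0 -Nc => N0.
have {}N0 : L2norm mu D (fun x => u t x - u c x) = 0.
  apply/eqP; rewrite -sqrf_eq0 eq_le sqr_ge0 andbT.
  by move: N0; rewrite ler_pdivrMr// mul0r.
apply: nt => r E g; have := hc r E g; congr (_ <= _).
have [r0 hut _] := g; have hr := hu (ltW r0); have hcL := hu c0.
have t0 : 0 <= t by exact: le_trans st.
have htL := hu t0.
rewrite /minorant; congr (_ - _ * _ - _ * _).
  apply/eqP; rewrite eq_sym -subr_eq0 -(ipB mD hut (L2B mD htL hr) (L2B mD hcL hr)).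
  rewrite -normr_le0 (_ : (fun x => _) = (fun x => u t x - u c x)); last first.
    by apply/funext => x; ring.
  by rewrite (le_trans (cauchy_schwarz mD hut (L2B mD htL hcL)))// N0 mulr0.
have sqN s' : ip (fun x => u s' x - u r x) (fun x => u s' x - u r x) =
    N (fun x => u s' x - u r x) ^+ 2.
  by rewrite sqr_sqrtr// ip_ge0.
rewrite !sqN; congr (_ ^+ 2); apply/eqP; rewrite eq_sym -subr_eq0 -normr_le0.
by rewrite (le_trans (L2norm_lip mD htL hcL hr))// N0.
Qed.

(** [flow_gronwall] with [K = eps * (e - e')], the bound that the minorants at the
    times between [s] and [t] give at the state at time [s]. *)
Lemma energy_dissipation s t e e' : 0 <= s -> s < t -> t - s <= 1 -> e' <= e ->
  energy_le s e -> (forall r E, regular_time r E -> s < r <= t -> e' <= E) ->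
  N (fun x => u t x - u s x) ^+ 2 <= 2 * expR 2 * eps * (e - e').
Proof.
move=> s0 st ts1 e'e hs he'; rewrite sqr_sqrtr ?ip_ge0//.
have : ip (fun x => u t x - u s x) (fun x => u t x - u s x) / 2 <=
    (expR (2 * (t - s)) - 1) * (eps * (e - e')).
  apply: (flow_gronwall hP) => //; first by rewrite mulr_ge0 ?(ltW heps)// subr_ge0.
  apply: filterS ae_regular_time => r /= gr srt; have /andP[sr rt] := srt.
  have r0 : 0 < r by exact: le_lt_trans sr.
  have [E g] := gr r0.
  have eE := he' r E g srt.
  have := hs r E g; rewrite /minorant.
  have [_ hut _] := g.
  have -> : ip (ut r) (fun x => u s x - u r x) = - ip (ut r) (fun x => u r x - u s x).
    rewrite -mulN1r -(ipZ mD (-1) hut); last by apply: (L2B mD); apply: hu => //; exact: ltW.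
    by congr (ip (ut r) _); apply/funext => x; rewrite mulN1r opprB.
  have -> : ip (fun x => u s x - u r x) (fun x => u s x - u r x) =
      ip (fun x => u r x - u s x) (fun x => u r x - u s x).
    by apply: eq_Rintegral => x _; ring.
  have alg (X Y : R) : E - eps^-1 * - X - (2 * eps)^-1 * Y <= e ->
      X <= eps * (e - e') + Y / 2.
    move=> h; rewrite -subr_ge0 -(pmulr_rge0 _ (_ : 0 < eps^-1)) ?invr_gt0//.
    have -> : eps^-1 * (eps * (e - e') + Y / 2 - X) = (e - e') + (2 * eps)^-1 * Y - eps^-1 * X.
      by field; rewrite gt_eqF.
    by lra.
  exact: alg.
have : (expR (2 * (t - s)) - 1) * (eps * (e - e')) <= expR 2 * (eps * (e - e')).
  rewrite ler_wpM2r//; first by rewrite mulr_ge0 ?(ltW heps)// subr_ge0.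
  have : expR (2 * (t - s)) <= expR 2 by rewrite ler_expR; lra.
  by lra.
have alg (X Y Z : R) : Y <= Z -> X / 2 <= Y -> X <= 2 * Z by lra.
move=> h1 h2; rewrite -[X in _ <= X](_ : 2 * (expR 2 * (eps * (e - e'))) = _); last by ring.
exact: alg h1 h2.
Qed.

Notation d1 := (L1dist a b).

Let iu t : 0 <= t -> mu.-integrable D (EFin \o u t).
Proof. by move=> t0; apply: (L2_integrable mD (lebesgue_itv_lty a b)); exact: hu. Qed.

(** Young's inequality turns the square root of the energy drop into a multiple of
    the drop, which can be summed over consecutive steps, and a fixed cost
    [kappa] of the step. *)
Lemma L1_step s t e e' (kappa : R) : 0 < kappa -> 0 <= s -> s < t -> t - s <= 1 ->
  e' <= e -> energy_le s e -> (forall r E, regular_time r E -> s < r <= t -> e' <= E) ->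
  d1 (u t) (u s) <= kappa + (b - a) * expR 2 * eps / kappa * (e - e').
Proof.
move=> k0 s0 st ts1 e'e hs he'.
have t0 : 0 <= t by rewrite (le_trans s0)// ltW.
have := energy_dissipation s0 st ts1 e'e hs he'.
have := L1dist_le_L2norm hab (hu t0) (hu s0).
have : 0 <= N (fun x => u t x - u s x) by exact: sqrtr_ge0.
have : Num.sqrt (b - a) ^+ 2 = b - a by rewrite sqr_sqrtr// subr_ge0 ltW.
have alg (S n' d' B E : R) : 0 <= B -> S ^+ 2 = B -> 0 <= n' -> d' <= S * n' ->
    n' ^+ 2 <= 2 * E * eps * (e - e') -> d' <= kappa + B * E * eps / kappa * (e - e').
  move=> B0 SB n0' dS nE.
  have h1 : S * n' <= kappa + B * n' ^+ 2 / (2 * kappa).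
    have h : 0 <= (kappa - S * n') ^+ 2 by exact: sqr_ge0.
    rewrite -(ler_pM2l (_ : 0 < 2 * kappa)) ?mulr_gt0//.
    rewrite mulrDr [X in _ <= _ + X](_ : _ = B * n' ^+ 2); last by field; rewrite gt_eqF.
    have : S ^+ 2 * n' ^+ 2 = B * n' ^+ 2 by rewrite SB.
    by move: h; rewrite !expr2; nra.
  apply: (le_trans dS); apply: (le_trans h1); rewrite lerD2l.
  apply: (@le_trans _ _ (B * (2 * E * eps * (e - e')) / (2 * kappa))).
    by rewrite ler_wpM2r ?invr_ge0 ?mulr_ge0 ?(ltW k0)// ler_wpM2l.
  by rewrite le_eqVlt; apply/orP; left; apply/eqP; field; rewrite gt_eqF.
move=> h1 h2 h3 h4; apply: alg h1 h2 h3 h4.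
by rewrite subr_ge0 ltW.
Qed.

(** Steps of length at most 1 between regular times, as the energy drops of
    consecutive steps then add up to [e0 - E]; their number is at most
    [2 * t + 1] because each one but the first can be taken longer than [1 / 2]. *)
Lemma L1_displacement t E e0 (kappa : R) : 0 < kappa -> energy_le 0 e0 -> regular_time t E ->
  d1 (u t) (u 0) <= kappa * (2 * t + 1) + (b - a) * expR 2 * eps / kappa * (e0 - E).
Proof.
move=> k0 h0 gt; set A := (b - a) * expR 2 * eps / kappa.
have A0 : 0 <= A.
  by rewrite /A !mulr_ge0 ?expR_ge0 ?invr_ge0 ?(ltW k0) ?(ltW heps)// subr_ge0 ltW.
have mono r r' F F' : regular_time r F -> regular_time r' F' -> r <= r' -> F' <= F.
  move=> g g' rr'; have [r0 _ _] := g; apply: (energy_le_regular g').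
  exact: energy_le_mono (ltW r0) rr' (regular_energy_le g).
have le0 r F : regular_time r F -> F <= e0.
  move=> g; have [r0 _ _] := g; apply: (energy_le_regular g).
  exact: energy_le_mono (lexx 0) (ltW r0) h0.
have H k : forall t E, regular_time t E -> 2 * t <= k.+1%:R ->
    d1 (u t) (u 0) <= kappa * k.+1%:R + A * (e0 - E).
  elim: k => [|k IH] {t E gt} t E gt tk.
    have [t0 _ _] := gt; rewrite mulr1; apply: L1_step => //.
    - by rewrite subr0; lra.
    - exact: le0 gt.
    - by move=> r F g /andP[_ rt]; exact: mono gt rt.
  have [t0 _ _] := gt.
  have [t2|t2] := leP t (2^-1).
    apply: (@le_trans _ _ (kappa + A * (e0 - E))); last first.
      by rewrite lerD2r ler_peMr ?(ltW k0)// ler1n.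
    apply: L1_step => //.
    - by rewrite subr0; lra.
    - exact: le0 gt.
    - by move=> r F g /andP[_ rt]; exact: mono gt rt.
  have mx0 : 0 <= Num.max 0 (t - 1) by rewrite le_max lexx.
  have mx1 : Num.max 0 (t - 1) < t - 2^-1 by rewrite gt_max; apply/andP; split; lra.
  have [s [Es [/andP[s1 s2] gs]]] := regular_time_dense mx0 mx1.
  move: s1; rewrite gt_max => /andP[s0 s1].
  have st : s < t by lra.
  have := IH s Es gs; rewrite -natr1 in tk *.
  move=> /(_ ltac:(lra)) h1.
  have h2 : d1 (u t) (u s) <= kappa + A * (Es - E).
    apply: L1_step => //.
    - exact: ltW.
    - by lra.
    - exact: mono gs gt (ltW st).
    - exact: regular_energy_le gs.
    - by move=> r F g /andP[_ rt]; exact: mono gt rt.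
  have := L1dist_triangle (iu (ltW t0)) (iu (ltW s0)) (iu (lexx 0)).
  move=> /le_trans; apply; apply: (le_trans (lerD h2 h1)).
  by rewrite le_eqVlt; apply/orP; left; apply/eqP; ring.
have [t0 _ _] := gt.
apply: (le_trans (H (Num.truncn (2 * t)) t E gt _)).
  by rewrite ltW// truncnS_gt.
rewrite lerD2r ler_wpM2l ?(ltW k0)// -natr1 lerD2r.
by rewrite truncn_le mulr_ge0 ?(ltW t0).
Qed.

Lemma L1_continuous t e : 0 <= t -> 0 < e -> exists2 d : R, 0 < d &
  forall s, 0 <= s -> `|s - t| < d -> d1 (u t) (u s) <= e.
Proof.
move=> t0 e0.
have S0 : 0 <= Num.sqrt (b - a) by exact: sqrtr_ge0.
have e1 : 0 < e / (Num.sqrt (b - a) + 1) by rewrite divr_gt0// ltr_wpDl.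
have /cvgrPdist_le/(_ _ e1) := flow_continuous hP t0.
rewrite near_withinE => /nbhs_ballP[d d0 H]; exists d => // s s0 st.
have := H s; rewrite /ball/= distrC => /(_ st s0).
rewrite sub0r normrN ger0_norm ?sqrtr_ge0// => h.
rewrite L1distC (le_trans (L1dist_le_L2norm hab (hu s0) (hu t0)))//.
apply: (@le_trans _ _ ((Num.sqrt (b - a) + 1) * (e / (Num.sqrt (b - a) + 1)))).
  by rewrite ler_pM ?sqrtr_ge0// lerDl.
by rewrite mulrC divfK// gt_eqF// ltr_wpDl.
Qed.

(** Bootstrap: as long as the path stays in the L1 ball of radius [delta] about
    [v], the energy stays above [e1], hence the displacement is small, hence
    the path stays well inside that ball. *)
Theorem metastability (v : R -> R) (T delta e0 e1 kappa : R) :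
  mu.-integrable D (EFin \o v) -> 0 < kappa -> e1 <= e0 -> energy_le 0 e0 ->
  (forall r E, regular_time r E -> d1 (u r) v <= delta -> E <= e0 -> e1 <= E) ->
  d1 (u 0) v + (kappa * (2 * T + 1) + (b - a) * expR 2 * eps / kappa * (e0 - e1)) < delta ->
  forall t, 0 <= t <= T ->
  d1 (u t) (u 0) <= kappa * (2 * T + 1) + (b - a) * expR 2 * eps / kappa * (e0 - e1).
Proof.
move=> iv k0 e10 h0 static; set A := (b - a) * expR 2 * eps / kappa.
set om := kappa * (2 * T + 1) + A * (e0 - e1) => small.
have A0 : 0 <= A.
  by rewrite /A !mulr_ge0 ?expR_ge0 ?invr_ge0 ?(ltW k0) ?(ltW heps)// subr_ge0 ltW.
have le0 r F : regular_time r F -> F <= e0.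
  move=> g; have [r0 _ _] := g; apply: (energy_le_regular g).
  exact: energy_le_mono (lexx 0) (ltW r0) h0.
have disp t : 0 < t <= T -> (forall r E, regular_time r E -> r < t -> e1 <= E) ->
    d1 (u t) (u 0) <= om.
  move=> /andP[t0 tT] ht; apply/ler_addgt0Pr => e e_gt0.
  have [d d0 hd] := L1_continuous (ltW t0) e_gt0.
  have mx0 : 0 <= Num.max 0 (t - d) by rewrite le_max lexx.
  have mx1 : Num.max 0 (t - d) < t by rewrite gt_max t0 ltrBlDr ltrDl.
  have [r [E [/andP[r1 r2] g]]] := regular_time_dense mx0 mx1.
  move: r1; rewrite gt_max => /andP[r0 r1].
  have := L1dist_triangle (iu (ltW t0)) (iu (ltW r0)) (iu (lexx 0)).
  move=> /le_trans; apply; rewrite addrC lerD//; last first.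
    by apply: hd; [exact: ltW|rewrite distrC ger0_norm ?subr_ge0 ?(ltW r2)//; lra].
  apply: (le_trans (L1_displacement k0 h0 g)); rewrite lerD//.
    by rewrite ler_wpM2l ?(ltW k0)//; lra.
  by rewrite ler_wpM2l// lerD2l lerN2; exact: ht g r2.
have disp0 t : 0 <= t <= T -> (forall r E, regular_time r E -> r < t -> e1 <= E) ->
    d1 (u t) (u 0) <= om.
  move=> /andP[]; rewrite le_eqVlt => /predU1P[<- T0 _|t0 tT]; last by apply: disp; rewrite t0.
  have T1 : 0 <= 2 * T + 1 by lra.
  rewrite (_ : d1 _ _ = 0); last first.
    by rewrite /L1dist /Rintegral; under eq_integral do rewrite subrr normr0; rewrite integral0.
  by rewrite /om addr_ge0 ?(mulr_ge0 A0) ?(mulr_ge0 (ltW k0))// subr_ge0.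
have near_v t : 0 <= t <= T -> (forall r E, regular_time r E -> r < t -> e1 <= E) ->
    d1 (u t) v < delta.
  move=> tT ht; have /andP[t0 _] := tT.
  have := L1dist_triangle (iu t0) (iu (lexx 0)) iv.
  have := disp0 t tT ht; lra.
have P t : 0 <= t <= T -> forall r E, regular_time r E -> r <= t -> e1 <= E.
  move: t; apply: real_induction.
  - by move=> r E [r0 _ _]; rewrite leNgt r0.
  - move=> t /andP[t0 tT] IH.
    have tT' : 0 <= t <= T by rewrite t0 ltW.
    have Pt : forall r E, regular_time r E -> r <= t -> e1 <= E.
      by apply: IH; rewrite t0 lexx.
    have dv := near_v t tT' (fun r E g rt => Pt r E g (ltW rt)).
    have gap0 : 0 < delta - d1 (u t) v by rewrite subr_gt0.
    have [d d0 hd] := L1_continuous t0 gap0.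
    exists (t + d / 2); first by rewrite ltrDl divr_gt0.
    move=> s /andP[ts sd] sT r E g rs.
    have [rt|tr] := leP r t; first exact: Pt g rt.
    have [r0 _ _] := g.
    apply: (static r E g); last exact: le0 g.
    apply: (le_trans (L1dist_triangle (iu (ltW r0)) (iu t0) iv)).
    rewrite -lerBrDr L1distC; apply: hd; first exact: ltW.
    by rewrite ger0_norm ?subr_ge0 ?(ltW tr)//; lra.
  - move=> t /andP[t0 tT] IH.
    have tT' : 0 <= t <= T by rewrite tT ltW.
    have Pt r E : regular_time r E -> r < t -> e1 <= E.
      move=> g rt; have [r0 _ _] := g.
      by apply: (IH r _ r E g) => //; rewrite (ltW r0).
    move=> r E g; rewrite le_eqVlt => /predU1P[rt|]; last exact: Pt.
    apply: (static r E g); last exact: le0 g.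
    by rewrite rt ltW// near_v.
move=> t tT; apply: disp0 => // r E g rt; apply: (P t tT r E g); exact: ltW.
Qed.

End gradient_flow.

(** * A chain rule inequality *)

Section chain_rule.
Context {R : realType}.
Notation mu := (@lebesgue_measure R).
Variables (psi : R -> R).
Hypotheses (psi0 : forall s, 0 <= psi s) (cpsi : continuous psi).

Lemma continuous_integrable_itv (f : R -> R) (x y : R) : continuous f ->
  mu.-integrable `[x, y] (EFin \o f).
Proof.
move=> cf; apply: continuous_compact_integrable; first exact: segment_compact.
exact: continuous_subspaceT.
Qed.

Let ipsi x y : mu.-integrable `[x, y] (EFin \o psi).
Proof. exact: continuous_integrable_itv. Qed.

Lemma Rintegral_itv_subadd (x y z : R) :
  \int[mu]_(s in `[x, z]) psi s <=
  \int[mu]_(s in `[x, y]) psi s + \int[mu]_(s in `[y, z]) psi s.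
Proof.
have ge0 (s t : R) : 0 <= \int[mu]_(q in `[s, t]) psi q by exact: Rintegral_ge0.
have sub (s t s' t' : R) : s' <= s -> t <= t' ->
    \int[mu]_(q in `[s, t]) psi q <= \int[mu]_(q in `[s', t']) psi q.
  move=> ss tt; apply: Rintegral_subset => //.
  by apply: subset_itv; rewrite bnd_simp.
have [zy|yz] := leP z y.
  by rewrite (le_trans (sub _ _ _ _ (lexx x) zy))// lerDl.
have [xy|yx] := leP x y; first by rewrite (Rintegral_itv_split xy (ltW yz)).
by rewrite (le_trans (sub _ _ _ _ (ltW yx) (lexx z)))// lerDr.
Qed.

Lemma Rintegral_itv_le (x y c : R) : 0 <= c -> (forall s, x <= s <= y -> psi s <= c) ->
  \int[mu]_(s in `[x, y]) psi s <= c * Num.max 0 (y - x).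
Proof.
move=> c0 pc; have [xy|yx] := leP x y; last first.
  by rewrite set_itv_ge ?bnd_simp -?ltNge// Rintegral_set0 mulr_ge0// le_max lexx.
rewrite max_r ?subr_ge0// -Rintegral_itv_cst//.
by apply: le_Rintegral => //; exact: integrable_itv_cst.
Qed.

Variables (a b : R) (f g : R -> R).
Hypothesis fg : ac_deriv a b f g.

Let mpsif : measurable_fun `[a, b] (psi \o f).
Proof.
exact: (measurableT_comp (continuous_measurable_fun cpsi) (ac_measurable fg)).
Qed.

Lemma integrable_chain : mu.-integrable `[a, b] (EFin \o (fun t => psi (f t) * `|g t|)).
Proof.
have [M fM] := ac_bounded fg.
have [K [_ psiK]] : bounded_set (psi @` `[- M, M]).
  apply: compact_bounded; apply: continuous_compact; last exact: segment_compact.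
  exact: continuous_subspaceT.
apply: (@dominated_integrable _ _ _ mu _ _ (fun t => (K + 1) * `|g t|)) => //.
- apply: measurable_funM => //; apply: measurableT_comp => //.
  exact: measurable_integrable fg.1.
- move=> t; rewrite /= in_itv/= => tab; rewrite normrM normr_id ler_wpM2r//.
  apply: (psiK (K + 1)); first by rewrite ltrDl.
  by exists (f t) => //; rewrite /= in_itv/= -ler_norml fM.
- by apply: integrableZ_R => //; apply: integrable_norm; exact: fg.1.
Qed.

(** On a short interval [psi \o f] is nearly constant, so the inequality holds up
    to a small multiple of the variation of [f]; these local estimates add up by
    [real_induction]. *)
Lemma chain_rule_le x y : a <= x -> x <= y -> y <= b ->
  \int[mu]_(s in `[f x, f y]) psi s <= \int[mu]_(t in `[x, y]) (psi (f t) * `|g t|).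
Proof.
move=> ax xy yb; have gn := integrable_norm fg.1.
have ig s t : a <= s -> t <= b -> mu.-integrable `[s, t] (EFin \o (fun t => `|g t|)).
  by move=> as_ tb; exact: integrable_subitv gn.
have ic s t : a <= s -> t <= b -> mu.-integrable `[s, t] (EFin \o (fun t => psi (f t) * `|g t|)).
  by move=> as_ tb; apply: integrable_subitv integrable_chain.
pose B eta t := \int[mu]_(q in `[x, t]) (psi (f q) * `|g q|) + eta * \int[mu]_(q in `[x, t]) `|g q|.
have key eta : 0 < eta -> forall t, x <= t <= y ->
    \int[mu]_(s in `[f x, f t]) psi s <= B eta t.
  move=> e0.
  have eta20 : 0 < eta / 2 by rewrite divr_gt0.
  have local t : x <= t <= y -> exists2 d : R, 0 < d & forall s s', x <= s -> s <= s' -> s' <= y ->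
      `|s - t| < d -> `|s' - t| < d ->
      \int[mu]_(z in `[f s, f s']) psi z <= \int[mu]_(q in `[s, s']) (psi (f q) * `|g q|)
        + eta * \int[mu]_(q in `[s, s']) `|g q|.
    move=> /andP[xt ty].
    have hc : psi z @[z --> f t] --> psi (f t) by exact: cpsi.
    have /cvgrPdist_le/(_ _ eta20)/nbhs_ballP[rho rho0 hrho] := hc.
    have rho20 : 0 < rho / 2 by rewrite divr_gt0.
    have [d d0 hd] := ac_unif_continuous fg rho20.
    exists d => // s s' xs ss' s'y std s'td.
    have xt' : a <= t <= b by rewrite (le_trans ax xt) (le_trans ty yb).
    have nf q : s <= q <= s' -> `|psi (f t) - psi (f q)| <= eta / 2.
      move=> /andP[sq qs']; apply: hrho.
      have qt : `|q - t| < d.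
        by move: std s'td; rewrite !ltr_norml => /andP[? ?] /andP[? ?]; apply/andP; split; lra.
      rewrite /ball/= distrC (le_lt_trans (hd t q xt' _ qt))//.
        by rewrite (le_trans ax)/= ?(le_trans xs)// (le_trans qs')// (le_trans s'y).
      by rewrite ltr_pdivrMr// ltr_pMr// ltr1n.
    have sab : a <= s <= b by rewrite (le_trans ax xs)/= (le_trans ss')// (le_trans s'y).
    have s'ab : a <= s' <= b.
      by rewrite (le_trans ax (le_trans xs ss'))/= (le_trans s'y).
    have c0 : 0 <= psi (f t) + eta / 2 by rewrite addr_ge0// ltW.
    apply: (@le_trans _ _ ((psi (f t) + eta / 2) * Num.max 0 (f s' - f s))).
      apply: Rintegral_itv_le => // z /andP[z1 z2].
      have : `|psi (f t) - psi z| <= eta / 2.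
        apply: hrho; rewrite /ball/= distrC.
        have h1 := hd t s xt' sab std; have h2 := hd t s' xt' s'ab s'td.
        apply: (@le_lt_trans _ _ (rho / 2)).
          by move: h1 h2; rewrite !ler_norml => /andP[? ?] /andP[? ?]; apply/andP; split; lra.
        by rewrite ltr_pdivrMr// ltr_pMr// ltr1n.
      rewrite distrC => /(le_trans (ler_norm _)); lra.
    have h3 : Num.max 0 (f s' - f s) <= \int[mu]_(q in `[s, s']) `|g q|.
      rewrite ge_max Rintegral_ge0//= (le_trans (ler_norm _))//.
      by apply: (ac_increment_le fg) => //; [case/andP: sab|case/andP: s'ab].
    apply: (le_trans (ler_wpM2l c0 h3)).
    have as_ : a <= s by case/andP: sab.
    have s'b : s' <= b by case/andP: s'ab.
    rewrite -RintegralZl//; last exact: ig.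
    rewrite -RintegralZl//; last exact: ig.
    rewrite -RintegralD//; [|exact: ic|by apply: integrableZ_R => //; exact: ig].
    apply: le_Rintegral => //.
    - by apply: integrableZ_R => //; exact: ig.
    - by apply: integrableD_R => //; [exact: ic|apply: integrableZ_R => //; exact: ig].
    move=> q; rewrite /= in_itv/= => qss; rewrite -mulrDl ler_wpM2r//.
    have := nf q qss => /(le_trans (ler_norm _)); lra.
  have Badd s s' : x <= s -> s <= s' -> s' <= y ->
      B eta s' = B eta s + (\int[mu]_(q in `[s, s']) (psi (f q) * `|g q|)
        + eta * \int[mu]_(q in `[s, s']) `|g q|).
    move=> xs ss' s'y; have s'b := le_trans s'y yb.
    rewrite /B (Rintegral_itv_split xs ss' (ig _ _ ax s'b)).
    by rewrite (Rintegral_itv_split xs ss' (ic _ _ ax s'b)); ring.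
  apply: real_induction.
  - rewrite set_itv1 Rintegral_set1 /B addr_ge0 ?mulr_ge0 ?(ltW e0) ?Rintegral_ge0//.
    by move=> q _; rewrite mulr_ge0.
  - move=> t /andP[xt ty] IH.
    have tt : x <= t <= y by rewrite xt ltW.
    have [d d0 hd] := local t tt.
    exists (t + d / 2); first by rewrite ltrDl divr_gt0.
    move=> s /andP[ts sd] sy.
    apply: (le_trans (Rintegral_itv_subadd _ (f t) _)).
    rewrite (Badd t s xt (ltW ts) sy) lerD//; first by apply: IH; rewrite xt lexx.
    apply: hd => //; [exact: ltW|by rewrite subrr normr0|].
    by rewrite ger0_norm ?subr_ge0 ?(ltW ts)//; lra.
  - move=> t /andP[xt ty] IH.
    have tt : x <= t <= y by rewrite ty ltW.
    have [d d0 hd] := local t tt.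
    pose s := Num.max x (t - d / 2).
    have xs : x <= s by rewrite le_max lexx.
    have st : s < t by rewrite gt_max xt ltrBlDr ltrDl divr_gt0.
    have sd : t - d / 2 <= s by rewrite le_max lexx orbT.
    apply: (le_trans (Rintegral_itv_subadd _ (f s) _)).
    rewrite (Badd s t xs (ltW st) ty) lerD//; first by apply: IH; rewrite xs.
    apply: hd => //; [exact: ltW| |by rewrite subrr normr0].
    by rewrite distrC ger0_norm ?subr_ge0 ?(ltW st)//; lra.
apply/ler_addgt0Pr => e e0.
set V := \int[mu]_(q in `[x, y]) `|g q|.
have V0 : 0 <= V by exact: Rintegral_ge0.
have V1 : 0 < V + 1 by rewrite ltr_wpDl.
have := key (e / (V + 1)) (divr_gt0 e0 V1) y; rewrite xy lexx => /(_ isT) /le_trans; apply.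
rewrite /B lerD2l -/V mulrAC ler_pdivrMr// ler_wpM2l ?(ltW e0)//.
by rewrite lerDl.
Qed.

End chain_rule.

(** * The energy of a transition *)

Section transition.
Context {R : realType}.
Notation mu := (@lebesgue_measure R).
Variables (n p : R).
Hypotheses (hp : 1 < p) (hnp : p < n).

Let p0 : 0 < p. Proof. exact: lt_trans hp. Qed.
Let n1 : 1 < n. Proof. exact: lt_trans hnp. Qed.
Let n0 : 0 < n. Proof. exact: lt_trans n1. Qed.
Let theta := (p - 1) / p.
Let theta0 : 0 < theta. Proof. by rewrite divr_gt0// subr_gt0. Qed.
Let Kp := (p / (p - 1)) `^ theta.

(** The weight in the Modica-Mortola inequality; its integral between the wells
    is the least energy of a transition. *)
Definition psi (s : R) : R := (p / (p - 1)) `^ ((p - 1) / p) * potential n s `^ ((p - 1) / p).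

Lemma psi_ge0 s : 0 <= psi s.
Proof. by rewrite mulr_ge0 ?powR_ge0. Qed.

Lemma psi_continuous : continuous psi.
Proof.
move=> s; apply: (@cvgMr R _ _ _ (fun s => potential n s `^ theta)).
have -> : (fun s => potential n s `^ theta) =
    (fun y => `|y| `^ theta) \o potential n.
  by apply/funext => y /=; rewrite ger0_norm ?potential_ge0.
rewrite -[potential n s]ger0_norm ?potential_ge0//.
apply: (@continuous_comp _ _ _ (potential n) (fun y => `|y| `^ theta)).
  exact: continuous_potential.
exact: continuous_normr_powR.
Qed.

Lemma psi_sign (sigma s : R) : sigma ^+ 2 = 1 -> psi (sigma * s) = psi s.
Proof. by move=> s2; rewrite /psi /potential exprMn s2 mul1r. Qed.

Lemma c_E : c_ n p = \int[mu]_(s in `[-1, 1]) psi s.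
Proof.
rewrite /c_ -RintegralZl//; apply: continuous_integrable_itv => s.
have h := psi_continuous.
have -> : (fun s => potential n s `^ ((p - 1) / p)) = (fun s => Kp^-1 * psi s).
  apply/funext => y; rewrite /psi mulrA mulVf ?mul1r//.
  by rewrite gt_eqF// powR_gt0// divr_gt0// subr_gt0.
by apply: (@cvgMr R); exact: h.
Qed.

(** Young's inequality with exponents [p] and [p / (p - 1)]. *)
Lemma psi_le_energy_density (eps : R) w g x : 0 < eps ->
  psi (w x) * `|g x| <= energy_density n p eps w g x.
Proof.
move=> e0.
have q0 : 0 < p / (p - 1) by rewrite divr_gt0// subr_gt0.
have F0 := potential_ge0 (w x) n0.
have := @conjugate_powR _ (eps `^ theta * `|g x|)
  ((p / (p - 1) * (potential n (w x) / eps)) `^ theta) p (p / (p - 1)).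
rewrite mulr_ge0 ?powR_ge0// => /(_ isT isT p0 q0).
have -> : p^-1 + (p / (p - 1))^-1 = 1.
  by field; rewrite ?gt_eqF// subr_gt0.
move=> /(_ erefl).
rewrite -powRrM (_ : theta * (p / (p - 1)) = 1); last first.
  by rewrite /theta; field; rewrite ?gt_eqF// subr_gt0.
rewrite powRr1; last by rewrite mulr_ge0 ?(ltW q0)// divr_ge0// ltW.
rewrite (powRM _ (powR_ge0 _ _))// -powRrM divfK ?gt_eqF//.
rewrite [X in _ <= _ + X](_ : _ = potential n (w x) / eps); last first.
  by field; rewrite ?gt_eqF//= ?gt_eqF// subr_gt0.
move/le_trans => h; apply: (le_trans _ (h _ _)); last by rewrite /energy_density.
rewrite powRM ?(ltW q0)//; last by rewrite divr_ge0// ltW.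
rewrite (powRM _ F0) ?invr_ge0 ?(ltW e0)//.
have -> : eps^-1 `^ theta = (eps `^ theta)^-1.
  by rewrite -powR_inv1 ?(ltW e0)// -powRrM mulN1r powRN.
rewrite le_eqVlt; apply/orP; left; apply/eqP; rewrite /psi -/theta.
by field; rewrite gt_eqF// powR_gt0.
Qed.

(** The constant of [psi_near_well]; the factor [2 `^ n] comes from
    [`|1 - s ^+ 2| <= 2 * `|s - sigma|]. *)
Definition well_cst : R := Kp * ((2 * n)^-1 * 2 `^ n) `^ theta.

Lemma well_cst_ge0 : 0 <= well_cst.
Proof. by rewrite mulr_ge0 ?powR_ge0. Qed.

Lemma psi_near_well (sigma eta s : R) : sigma ^+ 2 = 1 -> 0 <= eta -> `|s| <= 1 -> `|sigma| <= 1 ->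
  `|s - sigma| <= eta -> psi s <= well_cst * (eta `^ n) `^ theta.
Proof.
move=> s2 e0 s1 sg1 h.
have c0 : 0 <= (2 * n)^-1 by rewrite invr_ge0 mulr_ge0 ?ler0n ?(ltW n0).
have A0 : 0 <= (2 * n)^-1 * 2 `^ n by apply: mulr_ge0 => //; exact: powR_ge0.
have -> : well_cst * (eta `^ n) `^ theta = Kp * ((2 * n)^-1 * (2 * eta) `^ n) `^ theta.
  rewrite /well_cst -mulrA -(powRM _ A0 (powR_ge0 _ _)) -mulrA.
  by rewrite -(powRM _ (ler0n _ 2) e0).
apply: ler_wpM2l; first exact: powR_ge0.
apply: ge0_ler_powR; rewrite ?nnegrE.
- exact: ltW.
- exact: potential_ge0.
- by apply: mulr_ge0 => //; exact: powR_ge0.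
apply: ler_wpM2l => //.
apply: ge0_ler_powR; rewrite ?nnegrE//; first exact: ltW.
  by apply: mulr_ge0 => //; exact: ler0n.
rewrite -s2 subr_sqr normrM mulrC; apply: ler_pM => //; last by rewrite distrC.
apply: (le_trans (ler_normD _ _)); lra.
Qed.

(** Integrating [psi_near_well] over an interval of length [eta] is what produces
    the exponent [alpha]. *)
Lemma alpha_powR (eta : R) : 0 <= eta ->
  (eta `^ n) `^ theta * eta = (eta `^ n) `^ alpha n p.
Proof.
have a0 := alpha_gt0 hp hnp.
rewrite le_eqVlt => /predU1P[<-|e0]; first by rewrite mulr0 !powR0 ?gt_eqF.
have := @powRD _ (eta `^ n) theta n^-1.
rewrite (_ : (_ ==> _) = true); last by rewrite [eta `^ n == 0]gt_eqF ?powR_gt0 ?implybT.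
move=> /(_ isT).
by rewrite -/(alpha n p) => ->; rewrite -[in X in _ = _ * X]powRrM divff ?gt_eqF// powRr1// ltW.
Qed.

Lemma c_truncate (eta : R) : 0 <= eta <= 1 ->
  c_ n p <= \int[mu]_(s in `[-1 + eta, 1 - eta]) psi s
            + 2 * well_cst * (eta `^ n) `^ alpha n p.
Proof.
move=> /andP[e0 e1]; rewrite c_E.
set X := (eta `^ n) `^ alpha n p.
have C0 := well_cst_ge0.
have B0 : 0 <= well_cst * (eta `^ n) `^ theta by rewrite mulr_ge0// powR_ge0.
have BX : well_cst * (eta `^ n) `^ theta * eta = well_cst * X.
  by rewrite -mulrA alpha_powR.
have h1 := Rintegral_itv_subadd psi_ge0 psi_continuous (-1) (-1 + eta) 1.
have h2 := Rintegral_itv_subadd psi_ge0 psi_continuous (-1 + eta) (1 - eta) 1.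
have h3 : \int[mu]_(s in `[-1, -1 + eta]) psi s <= well_cst * X.
  rewrite -BX; apply: (le_trans (Rintegral_itv_le psi_continuous B0 (y := -1 + eta) (x := -1) _)).
    move=> s /andP[s1 s2]; apply: (@psi_near_well (-1)) => //.
    - by rewrite sqrrN expr1n.
    - by rewrite ler_norml s1/=; lra.
    - by rewrite normrN normr1.
    - by rewrite ger0_norm; lra.
  by rewrite addrAC subrr add0r max_r.
have h4 : \int[mu]_(s in `[1 - eta, 1]) psi s <= well_cst * X.
  rewrite -BX; apply: (le_trans (Rintegral_itv_le psi_continuous B0 (x := 1 - eta) (y := 1) _)).
    move=> s /andP[s1 s2]; apply: (@psi_near_well 1) => //.
    - by rewrite expr1n.
    - by rewrite ler_norml s2 andbT; lra.
    - by rewrite normr1.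
    - by rewrite ler0_norm; lra.
  by rewrite opprB addrC subrK max_r.
apply: (le_trans h1); apply: (le_trans (lerD h3 h2)).
by apply: (le_trans (lerD (lexx _) (lerD (lexx _) h4))); rewrite le_eqVlt; apply/orP; left; apply/eqP; ring.
Qed.

Variables (a b eps : R) (f g : R -> R).
Hypotheses (heps : 0 < eps) (fg : ac_deriv a b f g).
Hypothesis ie : mu.-integrable `[a, b] (EFin \o energy_density n p eps f g).

Lemma transition_energy (sigma eta x y : R) : a <= x -> x <= y -> y <= b ->
  sigma ^+ 2 = 1 -> 0 <= eta <= 1 -> `|f x + sigma| <= eta -> `|f y - sigma| <= eta ->
  c_ n p - 2 * well_cst * (eta `^ n) `^ alpha n p <= \int[mu]_(t in `[x, y]) energy_density n p eps f g t.
Proof.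
move=> ax xy yb s2 e01 hx hy; rewrite lerBlDr; apply: (le_trans (c_truncate e01)).
rewrite lerD2r.
have fg' : ac_deriv a b (fun t => sigma * f t) (fun t => sigma * g t).
  split; first by apply: integrableZ_R => //; exact: fg.1.
  move=> t /andP[at_ tb]; rewrite RintegralZl//; last exact: integrable_subitv fg.1.
  by rewrite (fg.2 t) ?at_// mulrDr.
have ns : `|sigma| = 1.
  by apply/eqP; rewrite -(@eqrXn2 _ 2)// -normrX s2 normr1 expr1n.
(* after multiplication by sigma the transition is increasing *)
have := chain_rule_le psi_ge0 psi_continuous fg' ax xy yb.
have sx : sigma * f x <= -1 + eta.
  have : `|sigma * f x + 1| <= eta by rewrite -s2 expr2 -mulrDr normrM ns mul1r.
  by move=> /(le_trans (ler_norm _)); lra.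
have sy : 1 - eta <= sigma * f y.
  have : `|sigma * f y - 1| <= eta by rewrite -s2 expr2 -mulrBr normrM ns mul1r.
  by rewrite distrC => /(le_trans (ler_norm _)); lra.
move=> h; apply: (le_trans (le_trans _ h)).
  apply: Rintegral_subset => //; last by move=> s _; exact: psi_ge0.
    by apply: subset_itv; rewrite bnd_simp.
  by apply: continuous_integrable_itv; exact: psi_continuous.
apply: le_Rintegral => //.
- exact: (integrable_subitv ax yb (integrable_chain psi_continuous fg')).
- exact: integrable_subitv ie.
- by move=> t _; rewrite psi_sign// normrM ns mul1r; exact: psi_le_energy_density.
Qed.

(** An averaging argument; within distance 1 of the well the potential is at least
    [(2 * n)^-1 * `|f t - sigma| `^ n], as the other factor of [1 - f t ^+ 2] is
    at least 1 in absolute value. *)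
Lemma good_point (sigma x y K : R) : a <= x -> x < y -> y <= b -> sigma ^+ 2 = 1 -> 0 < K ->
  \int[mu]_(t in `[x, y]) `|f t - sigma| <= (y - x) / 4 ->
  \int[mu]_(t in `[x, y]) energy_density n p eps f g t <= K ->
  exists t, [/\ x <= t <= y, `|f t - sigma| <= 1 &
    `|f t - sigma| `^ n <= 8 * n * eps * K / (y - x)].
Proof.
move=> ax xy yb s2 K0 h1 h2.
have yx0 : 0 < y - x by rewrite subr_gt0.
(* the two normalized terms have means at most 1 / 4 on [x, y], so their sum is
   somewhere at most 1 *)
pose K' := 4 * K / (y - x).
have K'0 : 0 < K' by rewrite divr_gt0// mulr_gt0.
have mf : measurable_fun `[x, y] f.
  apply: measurable_funS (ac_measurable fg) => //.
  by apply: subset_itv; rewrite bnd_simp.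
have i2 : mu.-integrable `[x, y] (EFin \o energy_density n p eps f g) by exact: integrable_subitv ie.
have [M fM] := ac_bounded fg.
have i1 : mu.-integrable `[x, y] (EFin \o (fun t => `|f t - sigma|)).
  apply: (@bounded_integrable_itv _ _ _ _ (M + `|sigma|)).
    by apply: measurableT_comp => //; exact: measurable_funB.
  move=> t /andP[xt ty]; rewrite normr_id (le_trans (ler_normB _ _))// lerD2r fM//.
  by rewrite (le_trans ax)//= (le_trans ty).
have [t txy ht] : exists2 t, x <= t <= y & `|f t - sigma| + K'^-1 * energy_density n p eps f g t <= 1.
  apply: contrapT => nt.
  have : \int[mu]_(t in `[x, y]) (1 : R) <=
      \int[mu]_(t in `[x, y]) (`|f t - sigma| + K'^-1 * energy_density n p eps f g t).
    apply: le_Rintegral => //; first exact: integrable_itv_cst.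
      by apply: integrableD_R => //; exact: integrableZ_R.
    move=> t; rewrite /= in_itv/= => txy; rewrite leNgt; apply/negP => /ltW tl.
    by apply: nt; exists t.
  rewrite Rintegral_itv_cst ?(ltW xy)// mul1r RintegralD//; last exact: integrableZ_R.
  rewrite RintegralZl// leNgt => /negP; apply.
  apply: (@le_lt_trans _ _ ((y - x) / 4 + K'^-1 * K)).
    by rewrite lerD// ler_wpM2l// invr_ge0 ltW.
  have -> : K'^-1 * K = (y - x) / 4.
    by rewrite /K'; field; rewrite ?gt_eqF.
  by lra.
have F0 := potential_ge0 (f t) n0.
have E0 := energy_density_ge0 f g t n0 p0 heps.
have d0 : 0 <= `|f t - sigma| by [].
have KE0 : 0 <= K'^-1 * energy_density n p eps f g t by rewrite mulr_ge0// invr_ge0 ltW.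
have fs1 : `|f t - sigma| <= 1 by lra.
exists t; split => //.
have ns : `|sigma| = 1.
  by apply/eqP; rewrite -(@eqrXn2 _ 2)// -normrX s2 normr1 expr1n.
have Fe : potential n (f t) / eps <= K'.
  have : K'^-1 * energy_density n p eps f g t <= 1 by lra.
  rewrite mulrC ler_pdivrMr// mul1r; apply: le_trans.
  by rewrite /energy_density lerDr divr_ge0 ?(ltW p0)// mulr_ge0 ?powR_ge0.
have : (2 * n)^-1 * `|f t - sigma| `^ n <= potential n (f t).
  rewrite ler_wpM2l ?invr_ge0 ?mulr_ge0 ?ler0n ?(ltW n0)// ge0_ler_powR ?nnegrE ?(ltW n0)//.
  rewrite -s2 subr_sqr normrM [`|sigma - _|]distrC ler_peMr//.
  have -> : sigma + f t = 2 * sigma + (f t - sigma) by ring.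
  rewrite -[leLHS](_ : `|2 * sigma| - 1 = 1); last first.
    by rewrite normrM ns mulr1 ger0_norm ?ler0n//; lra.
  rewrite lerBlDr -[X in `|X|](addrK (f t - sigma)) (le_trans (ler_normB _ _))// lerD2l//.
move=> /le_trans/(_ (_ : potential n (f t) <= eps * K')) => /(_ _)h.
have {}h : (2 * n)^-1 * `|f t - sigma| `^ n <= eps * K'.
  by apply: h; rewrite mulrC -ler_pdivrMr.
move: h; rewrite mulrC ler_pdivrMr ?mulr_gt0// => /le_trans; apply.
by rewrite le_eqVlt /K'; apply/orP; left; apply/eqP; field; rewrite gt_eqF.
Qed.

End transition.

(** * Lower bound for the energy near a step function *)

Section disjoint_pieces.
Context {R : realType}.
Notation mu := (@lebesgue_measure R).

Lemma sum_Rintegral_disjoint N (S : 'I_N -> set (measurableTypeR R)) (D : set (measurableTypeR R))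
    (e : R -> R) :
  measurable D -> (forall i, measurable (S i)) -> (forall i, S i `<=` D) ->
  (forall i j, i != j -> S i `&` S j = set0) ->
  mu.-integrable D (EFin \o e) -> (forall x, D x -> 0 <= e x) ->
  \sum_(i < N) \int[mu]_(x in S i) e x <= \int[mu]_(x in D) e x.
Proof.
move=> mD mS SD dS ie e0.
have iS i : mu.-integrable (S i) (EFin \o e) by exact: integrableS ie.
have SDU : \big[setU/set0]_(i < N) S i `<=` D.
  apply: (big_ind (fun A => A `<=` D)) => [x []|A B AD BD|i _]; last exact: SD.
  by rewrite subUset.
have mU : measurable (\big[setU/set0]_(i < N) S i).
  by apply: bigsetU_measurable => i _.
rewrite -lee_fin fine_Rintegral// -sumEFin.
under eq_bigr do rewrite fine_Rintegral//.
rewrite -ge0_integral_bigsetU//=.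
- apply: ge0_subset_integral => //; first exact: measurable_int ie.
- exact: index_enum_uniq.
- move=> i j _ _ [x [Six Sjx]]; apply/eqP/negPn/negP => /dS ij.
  by have : (S i `&` S j) x by []; rewrite ij.
- by apply: (measurable_funS mD SDU); exact: measurable_int ie.
- by move=> x /SDU Dx; rewrite lee_fin e0.
Qed.

End disjoint_pieces.

Section static_bound.
Context {R : realType}.
Notation mu := (@lebesgue_measure R).
Variables (n p a b : R) (N : nat) (h sg : 'I_N -> R) (v : R -> R) (r : R).
Hypotheses (hp : 1 < p) (hnp : p < n) (r0 : 0 < r).
Hypothesis hin : forall i, a <= h i - r /\ h i + r <= b.
Hypothesis hdis : forall i j : 'I_N, (i < j)%N -> h i + r < h j - r.
Hypothesis sg2 : forall i, sg i ^+ 2 = 1.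
Hypothesis vl : forall i x, h i - r <= x < h i -> v x = - sg i.
Hypothesis vr : forall i x, h i < x <= h i + r -> v x = sg i.
Hypothesis iv : mu.-integrable `[a, b] (EFin \o v).
Variable m : nat.

Let n0 : 0 < n. Proof. by rewrite (lt_trans _ hnp)// (lt_trans _ hp). Qed.
Let p0 : 0 < p. Proof. exact: lt_trans hp. Qed.
Let d : R := r / m.+1%:R.
Let d0 : 0 < d. Proof. by rewrite divr_gt0. Qed.

(** The constants of the successive lower bounds: passing from exponent [k] to
    [alpha * (k + 1)] costs the error of [transition_energy] at points
    provided by [good_point]. *)
Fixpoint stage_cst (j : nat) : R :=
  match j with
  | 0 => c_ n p
  | j'.+1 => 2 * well_cst n p *
      (8 * n * (1 + N%:R * stage_cst j') / d) `^ alpha n p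
  end.

Lemma c_ge0 : 0 <= c_ n p.
Proof. by rewrite c_E//; apply: Rintegral_ge0 => s _; exact: psi_ge0. Qed.

Lemma stage_cst_ge0 j : 0 <= stage_cst j.
Proof.
case: j => [|j] /=; first exact: c_ge0.
by rewrite !mulr_ge0 ?powR_ge0// well_cst_ge0.
Qed.

Variables (eps : R) (f g : R -> R).
Hypotheses (heps : 0 < eps <= 1) (fg : ac_deriv a b f g).
Hypothesis ie : mu.-integrable `[a, b] (EFin \o energy_density n p eps f g).
Hypothesis hL1 : L1dist a b f v <= d / 4.
Hypothesis hE : \int[mu]_(x in `[a, b]) energy_density n p eps f g x <=
  N%:R * c_ n p + eps `^ kseq n p m.

Let e0 : 0 < eps. Proof. by case/andP: heps. Qed.
Let I x y := \int[mu]_(t in `[x, y]) energy_density n p eps f g t.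
Let E_ge0 x : 0 <= energy_density n p eps f g x. Proof. exact: energy_density_ge0. Qed.

Let I_ge0 x y : 0 <= I x y.
Proof. exact: Rintegral_ge0. Qed.

Let I_sub x y x' y' : a <= x' -> x' <= x -> y <= y' -> y' <= b -> I x y <= I x' y'.
Proof.
move=> ax xx yy yb; apply: Rintegral_subset => //.
  by apply: subset_itv; rewrite bnd_simp.
exact: (integrable_subitv ax yb ie).
Qed.

Let I_split x y z : a <= x -> x <= y -> y <= z -> z <= b -> I x z = I x y + I y z.
Proof.
move=> ax xy yz zb; apply: Rintegral_itv_split => //.
exact: (integrable_subitv ax zb ie).
Qed.

Let rho j : R := d * j.+1%:R.
Let rho_gt0 j : 0 < rho j. Proof. by rewrite mulr_gt0. Qed.
Let rhoS j : rho j.+1 = rho j + d. Proof. by rewrite /rho -[in LHS]natr1 mulrDr mulr1. Qed.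
Let rho_le j : (j <= m)%N -> rho j <= r.
Proof.
by move=> jm; rewrite /rho /d mulrAC ler_pdivrMr// ler_wpM2l ?(ltW r0)// ler_nat.
Qed.

Let pieces_le j : (j <= m)%N -> \sum_(i < N) I (h i - rho j) (h i + rho j) <=
  \int[mu]_(x in `[a, b]) energy_density n p eps f g x.
Proof.
move=> jm; have rj := rho_le jm.
apply: (@sum_Rintegral_disjoint _ _ (fun i => `[h i - rho j, h i + rho j]%classic)) => //.
  move=> i; have [h1 h2] := hin i.
  by apply: subset_itv; rewrite bnd_simp; lra.
have D (i k : 'I_N) : (i < k)%N ->
    `[h i - rho j, h i + rho j]%classic `&` `[h k - rho j, h k + rho j]%classic = set0.
  move=> /hdis ik; apply/seteqP; split => // x [] /=; rewrite !in_itv/=.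
  by move=> /andP[_ x1] /andP[x2 _]; lra.
move=> i k; rewrite neq_ltn => /orP[/D//|/D].
by rewrite setIC.
Qed.

Let sum_stage j : (j <= m)%N ->
  \sum_(i < N) I (h i - rho j) (h i + rho j) <= N%:R * c_ n p + eps `^ kseq n p m.
Proof. by move=> jm; apply: le_trans (pieces_le jm) hE. Qed.

Let mean_J sigma x y : a <= x -> x <= y -> y <= b -> (forall t, x <= t <= y -> v t = sigma) ->
  \int[mu]_(t in `[x, y]) `|f t - sigma| <= d / 4.
Proof.
move=> ax xy yb vs; apply: le_trans hL1.
rewrite (@eq_Rintegral _ _ _ mu _ (fun t => `|f t - v t|)); last first.
  by move=> t; rewrite inE/= in_itv/= => txy; rewrite vs.
have [M fM] := ac_bounded fg.
have i_f : mu.-integrable `[a, b] (EFin \o f).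
  exact: (bounded_integrable_itv (ac_measurable fg) fM).
apply: Rintegral_subset => //; first by apply: subset_itv; rewrite bnd_simp.
by apply: integrable_norm; exact: integrableB_R.
Qed.

(** The pieces near the jumps exhaust the energy, up to [eps `^ k]: little is left
    for the layers around them. *)
Let annulus j : (j.+1 <= m)%N -> forall K,
  (forall i, c_ n p - K * eps `^ kseq n p j.+1 <= I (h i - rho j) (h i + rho j)) ->
  forall i, I (h i - rho j.+1) (h i - rho j) + I (h i + rho j) (h i + rho j.+1) <=
    (1 + N%:R * K) * eps `^ kseq n p j.+1.
Proof.
move=> jm K IH i0.
set J := I _ _ + _.
have := sum_stage jm.
have rj := rho_le jm.
have rS := rhoS j.
have rg := rho_gt0 j.
have dd := d0.
have split3 i : I (h i - rho j.+1) (h i + rho j.+1) =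
    I (h i - rho j) (h i + rho j) + (I (h i - rho j.+1) (h i - rho j) + I (h i + rho j) (h i + rho j.+1)).
  have [h1 h2] := hin i.
  rewrite (@I_split (h i - rho j.+1) (h i - rho j)); [|lra..].
  rewrite (@I_split (h i - rho j) (h i + rho j)); [|lra..].
  by ring.
have : \sum_(i < N) (c_ n p - K * eps `^ kseq n p j.+1 + (if i == i0 then J else 0)) <=
    \sum_(i < N) I (h i - rho j.+1) (h i + rho j.+1).
  apply: ler_sum => i _; rewrite split3 lerD ?IH//.
  by case: eqP => [->//|_]; rewrite addr_ge0.
rewrite big_split/= -big_mkcond/= big_pred1_eq sumr_const card_ord -mulr_natl => h1 h2.
have e1 : eps `^ kseq n p m <= eps `^ kseq n p j.+1.
  have j1 : (1 <= j.+1 <= m)%N by [].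
  have /andP[_ k2] := kseq_nondecreasing hp hnp j1.
  exact: ger_powR heps _ _ k2.
have := le_trans h1 h2; lra.
Qed.

(** Each stage moves the endpoints of the transition into the next layer. *)
Let stage j : (j < m)%N -> forall i,
  c_ n p - stage_cst j * eps `^ kseq n p j.+1 <= I (h i - rho j) (h i + rho j).
Proof.
elim: j => [|j IH] jm i; first by rewrite /= powRr0 mulr1 subrr.
set K := (1 + N%:R * stage_cst j) * eps `^ kseq n p j.+1.
have K0 : 0 < K.
  rewrite mulr_gt0 ?powR_gt0// ltr_wpDr ?ltr01// mulr_ge0//; exact: stage_cst_ge0.
have JK := annulus (ltnW jm) (IH (ltnW jm)) i.
have rj := rho_le (ltnW jm).
have rj' := rho_le (ltnW (ltnW jm)).
have rS := rhoS j.
have rg := rho_gt0 j.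
have dd := d0.
have [h1 h2] := hin i.
have sN : (- sg i) ^+ 2 = 1 by rewrite sqrrN.
have L1 : a <= h i - rho j.+1 by lra.
have L2 : h i - rho j.+1 < h i - rho j by lra.
have L3 : h i - rho j <= b by lra.
have R1 : a <= h i + rho j by lra.
have R2 : h i + rho j < h i + rho j.+1 by lra.
have R3 : h i + rho j.+1 <= b by lra.
have ww : h i - rho j - (h i - rho j.+1) = d by lra.
have ww' : h i + rho j.+1 - (h i + rho j) = d by lra.
have ML : \int[mu]_(t in `[h i - rho j.+1, h i - rho j]) `|f t - - sg i| <=
    (h i - rho j - (h i - rho j.+1)) / 4.
  rewrite ww; apply: (mean_J L1 (ltW L2) L3) => t /andP[? ?].
  by apply: vl; apply/andP; split; lra.
have MR : \int[mu]_(t in `[h i + rho j, h i + rho j.+1]) `|f t - sg i| <=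
    (h i + rho j.+1 - (h i + rho j)) / 4.
  rewrite ww'; apply: (mean_J R1 (ltW R2) R3) => t /andP[? ?].
  by apply: vr; apply/andP; split; lra.
have EL : I (h i - rho j.+1) (h i - rho j) <= K by apply: le_trans JK; rewrite lerDl.
have ER : I (h i + rho j) (h i + rho j.+1) <= K by apply: le_trans JK; rewrite lerDr.
have [xl [xl1 xl2 xl3]] := good_point hp hnp e0 fg ie L1 L2 L3 sN K0 ML EL.
have [xr [xr1 xr2 xr3]] := good_point hp hnp e0 fg ie R1 R2 R3 (sg2 i) K0 MR ER.
have /andP[l1 l2] := xl1; have /andP[r1 r2] := xr1.
rewrite ww in xl3; rewrite ww' in xr3.
pose eta := Num.max `|f xl - - sg i| `|f xr - sg i|.
have eta01 : 0 <= eta <= 1 by rewrite le_max normr_ge0 ge_max xl2 xr2.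
have T1 : a <= xl by exact: le_trans l1.
have T2 : xl <= xr.
  by apply: (le_trans l2); apply: (le_trans _ r1); rewrite lerD2l (@le_trans _ _ 0) ?oppr_le0 ?(ltW rg).
have T3 : xr <= b by exact: le_trans R3.
have T4 : `|f xl + sg i| <= eta by rewrite -[X in _ + X]opprK le_max lexx.
have T5 : `|f xr - sg i| <= eta by rewrite le_max lexx orbT.
have ht := transition_energy hp hnp e0 fg ie T1 T2 T3 (sg2 i) eta01 T4 T5.
apply: (@le_trans _ _ (I xl xr)); last exact: (I_sub L1 l1 r2 R3).
apply: (le_trans _ ht); rewrite lerD2l lerN2.
have -> : stage_cst j.+1 * eps `^ kseq n p j.+2 = 2 * well_cst n p *
    ((8 * n * (1 + N%:R * stage_cst j) / d) `^ alpha n p * eps `^ kseq n p j.+2).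
  by rewrite mulrA.
apply: ler_wpM2l; first by rewrite mulr_ge0 ?ler0n// well_cst_ge0.
have a0 := alpha_gt0 hp hnp.
have etaK : eta `^ n <= 8 * n * eps * K / d.
  by rewrite /eta /Num.max; case: ifP.
apply: (@le_trans _ _ ((8 * n * eps * K / d) `^ alpha n p)).
  by rewrite ge0_ler_powR ?nnegrE ?powR_ge0 ?(ltW a0)// (le_trans _ etaK)// powR_ge0.
have -> : 8 * n * eps * K / d =
    (8 * n * (1 + N%:R * stage_cst j) / d) * eps `^ (kseq n p j.+1 + 1).
  have j1 : (1 <= j.+1 <= j.+1)%N by rewrite leqnn.
  have /andP[k1 _] := kseq_nondecreasing hp hnp j1.
  have k2 : 0 < kseq n p j.+1 + 1 by rewrite ltr_wpDl.
  rewrite -(mulr_powRB1 (ltW e0) k2) addrK.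
  by rewrite /K; field; rewrite gt_eqF.
have S0 := stage_cst_ge0 j.
have NS : 0 <= 1 + N%:R * stage_cst j by rewrite addr_ge0// mulr_ge0.
rewrite powRM ?powR_ge0//; last first.
  by apply: divr_ge0; [apply: mulr_ge0 => //; apply: mulr_ge0; rewrite ?ler0n ?(ltW n0)|exact: ltW].
by rewrite -powRrM mulrC (kseqS n p j) [alpha n p * _]mulrC mulrC.
Qed.

Lemma ac_static_bound : (1 <= m)%N ->
  N%:R * c_ n p - N%:R * stage_cst m.-1 * eps `^ kseq n p m <=
  \int[mu]_(x in `[a, b]) energy_density n p eps f g x.
Proof.
move=> m1; have jm : (m.-1 < m)%N by rewrite prednK.
have st := stage jm; rewrite prednK// in st.
have rj := rho_le (ltnW jm); have rg := rho_gt0 m.-1.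
have h1 : \sum_(i < N) I (h i - rho m.-1) (h i + rho m.-1) <=
    \int[mu]_(x in `[a, b]) energy_density n p eps f g x.
  by apply: pieces_le; exact: ltnW.
apply: le_trans h1; rewrite -mulrA -mulrBr mulr_natl -[X in _ *+ X]card_ord -sumr_const.
by apply: ler_sum => i _; exact: st.
Qed.

End static_bound.

Section jumps.
Context {R : realType}.
Notation mu := (@lebesgue_measure R).
Variables (a b : R) (N : nat) (h : 'I_N -> R) (v : R -> R).
Hypothesis hv : piecewise_const_jumps a b h v.

Let hin i : a < h i < b. Proof. by have [[+ _] _ _ _] := hv; exact. Qed.
Let hlt (i j : 'I_N) : (i < j)%N -> h i < h j.
Proof. by have [[_ +] _ _ _] := hv; exact. Qed.
Let vpm x : a <= x <= b -> v x = -1 \/ v x = 1.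
Proof. by have [_ + _ _] := hv; exact. Qed.
Let vcst x y : a <= x -> x <= y -> y <= b -> (forall i, ~ (x <= h i <= y)) -> v x = v y.
Proof. by have [_ _ + _] := hv; exact. Qed.

(** A common radius of disjoint neighbourhoods of the jumps; [sg i] is the value
    of [v] to the right of [h i]. *)
Lemma jump_data : exists r : R, exists sg : 'I_N -> R,
  [/\ 0 < r,
      (forall i, a <= h i - r /\ h i + r <= b) /\
      (forall i j : 'I_N, (i < j)%N -> h i + r < h j - r),
      forall i, sg i ^+ 2 = 1,
      forall i x, h i - r <= x < h i -> v x = - sg i &
      forall i x, h i < x <= h i + r -> v x = sg i].
Proof.
have [r [r0 [rin rdis]]] : exists r : R, 0 < r /\
    ((forall i, a <= h i - r /\ h i + r <= b) /\
     (forall i j : 'I_N, (i < j)%N -> h i + r < h j - r)).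
  have near_lt (c : R) : 0 < c -> \forall r \near 0^'+, r < c.
    by move=> c0; exact: nbhs_right_lt.
  have H1 : \forall r \near (0 : R)^'+, forall i, a <= h i - r /\ h i + r <= b.
    apply: filter_forall => i; have /andP[ai ib] := hin i.
    near=> r; split.
      rewrite lerBrDr -lerBrDl ltW//; near: r; apply: near_lt; by rewrite subr_gt0.
    rewrite -lerBrDl ltW//; near: r; apply: near_lt; by rewrite subr_gt0.
  have H2 : \forall r \near (0 : R)^'+, forall ij : 'I_N * 'I_N, (ij.1 < ij.2)%N ->
      h ij.1 + r < h ij.2 - r.
    apply: filter_forall => -[i j] /=.
    have [ij|] := boolP (i < j)%N; last by move=> _; apply: nearW.
    have hij := hlt ij.
    near=> r => _; suff : r < (h j - h i) / 2 by lra.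
    by near: r; apply: near_lt; rewrite divr_gt0// subr_gt0.
  have [r [[r0 r1] r2]] : exists r : R, (0 < r /\ forall i, a <= h i - r /\ h i + r <= b) /\
      forall ij : 'I_N * 'I_N, (ij.1 < ij.2)%N -> h ij.1 + r < h ij.2 - r.
    near (0 : R)^'+ => r; exists r; split; first split.
    - by near: r; exact: nbhs_right_gt.
    - by near: r; exact: H1.
    - by near: r; exact: H2.
  by exists r; split => //; split => // i j ij; exact: (r2 (i, j)).
exists r, (fun i => v (h i + r)).
have right i x : h i < x <= h i + r -> v x = v (h i + r).
  move=> /andP[ix xr]; have [r1 r2] := rin i; have /andP[ai _] := hin i.
  apply: vcst => //; first by rewrite ltW// (lt_trans ai).
  move=> k /andP[k1 k2]; have [ki|ik|/val_inj ki] := ltngtP k i.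
  - by have := hlt ki; lra.
  - by have := rdis _ _ ik; lra.
  - by move: k1; rewrite ki; lra.
have left i x : h i - r <= x < h i -> v x = v (h i - r).
  move=> /andP[rx xi]; have [r1 r2] := rin i; have /andP[_ ib] := hin i.
  apply/esym; apply: vcst => //; first by rewrite ltW// (lt_trans xi).
  move=> k /andP[k1 k2]; have [ki|ik|/val_inj ki] := ltngtP k i.
  - by have := rdis _ _ ki; lra.
  - by have := hlt ik; lra.
  - by move: k2; rewrite ki; lra.
have rinb i : a <= h i - r <= b /\ a <= h i + r <= b.
  by have [? ?] := rin i; split; apply/andP; split; lra.
have opp i : v (h i - r) = - v (h i + r).
  have [b1 b2] := rinb i.
  have : v (h i - r) <> v (h i + r).
    have [_ _ _ /(_ i) [l0 [r1 [hl hr lr]]]] := hv => E; apply: lr.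
    have -> : l0 = v (h i - r).
      apply: (cvg_unique _ hl) => //; apply: cvg_near_cst.
      near=> z; apply: left; apply/andP; split; near: z.
        by apply: nbhs_left_ge; rewrite ltrBlDr ltrDl.
      exact: nbhs_left_lt.
    rewrite E; apply/esym; apply: (cvg_unique _ hr) => //; apply: cvg_near_cst.
    near=> z; apply: right; apply/andP; split; near: z.
      exact: nbhs_right_gt.
    by apply: nbhs_right_le; rewrite ltrDl.
  by case: (vpm b1) => ->; case: (vpm b2) => -> //; rewrite opprK.
split => //.
- by move=> i; have [_ b2] := rinb i; case: (vpm b2) => ->; rewrite ?sqrrN expr1n.
- by move=> i x hx; rewrite (left i x hx) opp.
Unshelve. all: by end_near. Qed.

(** Off its finitely many jump points [v] is locally constant. *)
Lemma jump_measurable : measurable_fun (`[a, b]%classic : set (measurableTypeR R)) v.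
Proof.
pose O := [set x | a < x < b /\ forall i, h i != x].
have nearO (x : R) : O x -> \forall y \near x, O y /\ v y = v x.
  move=> [/andP[ax xb] xh].
  have sepi i : \forall y \near x, (h i < x -> h i < y) /\ (x < h i -> y < h i).
    have := xh i; rewrite neq_lt => /orP[hx|hx].
      near=> y; split => [_|]; last by move=> /lt_trans/(_ hx); rewrite ltxx.
      by near: y; exact: lt_nbhsr.
    near=> y; split => [/lt_trans/(_ hx)|_]; first by rewrite ltxx.
    by near: y; exact: lt_nbhsl.
  have sep : \forall y \near x, forall i, (h i < x -> h i < y) /\ (x < h i -> y < h i).
    exact: (filter_forall (F := nbhs x) _ sepi).
  near=> y.
  have ys : forall i, (h i < x -> h i < y) /\ (x < h i -> y < h i) by near: y; exact: sep.
  have ay : a < y by near: y; exact: lt_nbhsr.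
  have yb : y < b by near: y; exact: lt_nbhsl.
  split.
    split; first by rewrite ay.
    move=> i; have [y1 y2] := ys i.
    by have := xh i; rewrite neq_lt => /orP[/y1/lt_eqF->//|/y2/gt_eqF->].
  have [yx|xy] := leP y x.
    apply: vcst => //; [exact: ltW|exact: ltW|].
    move=> i /andP[yi ix]; have [y1 _] := ys i.
    by have := y1 (_ : h i < x); rewrite lt_neqAle xh ix => /(_ isT); rewrite ltNge yi.
  apply/esym; apply: vcst; [exact: ltW|exact: ltW|exact: ltW|].
  move=> i /andP[xi iy]; have [_ y2] := ys i.
  have := y2 (_ : x < h i); rewrite lt_neqAle eq_sym xh xi => /(_ isT).
  by rewrite ltNge iy.
have nearOO (x : R) : O x -> \forall y \near x, O y.
  by move=> /nearO xO; apply: (filterS (F := nbhs x) _ xO) => y [].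
have nearv (x : R) : O x -> \forall y \near x, v x = v y.
  by move=> /nearO xO; apply: (filterS (F := nbhs x) _ xO) => y [].
have oO : open O by rewrite openE => x; exact: nearOO.
have vc (x : R) : O x -> v y @[y --> x] --> v x.
  move=> Ox; apply: (cvg_trans (near_eq_cvg (nearv x Ox))); exact: cvg_cst.
have mO : measurable_fun O v.
  by apply: open_continuous_measurable_fun => // x; rewrite inE; exact: vc.
pose F := `[a, b]%classic `\` O.
have cF : countable F.
  apply: finite_set_countable.
  apply: (@sub_finite_set _ _ (range h `|` [set a; b])); last first.
    by rewrite finite_setU; split => //; exact: finite_image.
  move=> x [/=]; rewrite in_itv/= => /andP[ax xb] nO.
  have [/existsP[i /eqP hx]|nh] := boolP [exists i, h i == x]; first by left; exists i.
  right; have [->|xa] := eqVneq x a; first by left.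
  have [->|xb'] := eqVneq x b; first by right.
  exfalso; apply: nO; split; first by rewrite !lt_neqAle ax xb eq_sym xa xb'.
  by move=> i; apply: contra nh => hx; apply/existsP; exists i.
have mcount (A : set R) : countable A -> measurable A by exact: countable_measurable.
have mF : measurable_fun F v.
  by move=> _ Y _; apply: mcount; apply: sub_countable cF; apply: subset_card_le => x [].
have OD : O `<=` `[a, b]%classic.
  by move=> x [/andP[ax xb] _]; rewrite /= in_itv/= !ltW.
rewrite -(setDUK OD).
by apply/measurable_funU; [exact: open_measurable|exact: mcount|split].
Unshelve. all: by end_near. Qed.

Lemma jump_integrable : mu.-integrable `[a, b] (EFin \o v).
Proof.
apply: (@bounded_integrable_itv _ _ _ _ 1); first exact: jump_measurable.
by move=> x /vpm[] ->; rewrite ?normrN normr1.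
Qed.

End jumps.

Section static_bound_weak.
Context {R : realType}.
Notation mu := (@lebesgue_measure R).

(** [ac_static_bound] for the absolutely continuous representative of [w]. *)
Theorem static_bound (n p a b : R) (N : nat) (h : 'I_N -> R) (v : R -> R) (m : nat) :
  1 < p -> p < n -> a < b -> piecewise_const_jumps a b h v -> (1 <= m)%N ->
  exists delta C : R, [/\ 0 < delta, 0 <= C & forall (eps : R) (w g : R -> R),
    0 < eps <= 1 -> weak_deriv a b w g -> measurable_fun `[a, b] w ->
    mu.-integrable `[a, b] (EFin \o energy_density n p eps w g) ->
    L1dist a b w v <= delta ->
    \int[mu]_(x in `[a, b]) energy_density n p eps w g x <= N%:R * c_ n p + eps `^ kseq n p m ->
    N%:R * c_ n p - C * eps `^ kseq n p m <= \int[mu]_(x in `[a, b]) energy_density n p eps w g x].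
Proof.
move=> hp hnp hab hv m1.
have [r [sg [r0 [rin rdis] sg2 vl vr]]] := jump_data hv.
have iv := jump_integrable hv.
have d0 : 0 < r / m.+1%:R by rewrite divr_gt0.
exists (r / m.+1%:R / 4), (N%:R * stage_cst n p N r m m.-1); split.
- by rewrite divr_gt0.
- by rewrite mulr_ge0// stage_cst_ge0.
move=> eps w g heps wg mw ie hd hE.
have [f fg wf] := wg.
have mf := ac_measurable fg.
have mg := measurable_integrable fg.1.
have n1 : 1 < n by exact: lt_trans hnp.
have mD : measurable (`[a, b]%classic : set (measurableTypeR R)) by exact: measurable_itv.
have mef := measurable_energy_density p eps n1 mf mg.
have mew := measurable_energy_density p eps n1 mw mg.
have ef : {ae mu, forall x, `[a, b]%classic x -> energy_density n p eps w g x = energy_density n p eps f g x}.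
  by apply: filterS (ae_itv wf) => x /= wfx xab; rewrite /energy_density wfx.
have E : \int[mu]_(x in `[a, b]) energy_density n p eps w g x =
    \int[mu]_(x in `[a, b]) energy_density n p eps f g x.
  by apply: (@ae_eq_Rintegral _ _ _ mu).
have ief : mu.-integrable `[a, b] (EFin \o energy_density n p eps f g).
  exact: (@ae_eq_integrable _ _ _ mu _ _ _ mD mef ef ie).
rewrite E in hE *.
have mv := measurable_integrable iv.
have fw : {ae mu, forall x, `[a, b]%classic x -> f x = w x}.
  by apply: filterS (ae_itv wf) => x wfx xab; rewrite wfx.
have hd' : L1dist a b f v <= r / m.+1%:R / 4 by rewrite (L1dist_ae mf mw mv fw).
exact: (ac_static_bound hp hnp r0 rin rdis sg2 vl vr iv heps fg ief hd' hE m1).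
Qed.

End static_bound_weak.

(** * Slow motion *)

Section neumann.
Context {R : realType}.
Notation mu := (@lebesgue_measure R).

Lemma neumann_path (n p a b eps : R) (u0 : R -> R) (u : R -> R -> R) :
  neumann_solution n p a b eps u0 u ->
  (forall x, a <= x <= b -> u 0 x = u0 x) /\
  exists ut : R -> R -> R, L2_path a b u ut /\
    {ae mu, forall t : R, 0 < t -> exists q w : R -> R,
      [/\ weak_deriv a b (u t) q, ac_deriv a b (fun x => pflux p (q x)) w,
          q a = 0 /\ q b = 0 &
          {ae mu, forall x, a <= x <= b ->
            ut t x = eps `^ p * w x - derive1 (potential n) (u t x)}]}.
Proof.
move=> [h0 hL2 hc [ut [m1 m2 m3 m4]]]; split => //; exists ut; split => //; split => //.
pose F t := \int[mu]_(x in `[a, b]) ((u t x - u 0 x) ^+ 2).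
have hf : F t @[t --> 0^'+] --> (0 : R) by exact: fine_cvg hc.
have hs : Num.sqrt z @[z --> (0 : R)] --> (0 : R).
  by have := @sqrt_continuous R 0; rewrite /continuous_at sqrtr0.
exact: (cvg_comp F Num.sqrt hf hs).
Qed.

Lemma L1norm_L1dist (a b : R) (f g : R -> R) :
  mu.-integrable `[a, b] (EFin \o f) -> mu.-integrable `[a, b] (EFin \o g) ->
  L1norm a b (fun x => f x - g x) = (L1dist a b f g)%:E.
Proof.
move=> hf hg; rewrite /L1dist fine_Rintegral//.
by apply: integrable_norm; exact: integrableB_R.
Qed.

End neumann.

Theorem theorem3 (R : realType) (n p a b : R) (hp : 1 < p) (hnp : p < n)
    (hab : a < b) (N : nat) (h : 'I_N -> R) (v : R -> R)
    (hv : piecewise_const_jumps a b h v)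
    (u0 : R -> R -> R) (u : R -> R -> R -> R)
    (hu : forall eps : R, 0 < eps -> neumann_solution n p a b eps (u0 eps) (u eps))
    (hu0 : L1norm a b (fun x => u0 eps x - v x) @[eps --> 0^'+]
             --> (0 : \bar R)%E)
    (m : nat) (hm : (1 <= m)%N)
    (hE : \forall eps \near 0^'+,
        (energy n p a b eps (u0 eps)
           <= (N%:R * c_ n p + eps `^ kseq n p m)%:E)%E)
    (l : R) (hl : 0 < l) :
  ereal_sup [set L1norm a b (fun x => u eps t x - v x)
            | t in [set t : R | 0 <= t <= l * eps `^ (- kseq n p m)]]
    @[eps --> 0^'+] --> (0 : \bar R)%E.
Proof.
have [delta [C [delta0 C0 static]]] := static_bound hp hnp hab hv hm.
have iv := jump_integrable hv.
set K := kseq n p m.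
have K0 : 0 <= K.
  have m1 : (1 <= m <= m)%N by rewrite hm leqnn.
  by have /andP[] := kseq_nondecreasing hp hnp m1.
pose A := 2 * l + 1 + (b - a) * expR 2 * (1 + C).
have A0 : 0 < A.
  rewrite addr_gt0//; last by rewrite !mulr_gt0 ?expR_gt0 ?subr_gt0// ltr_wpDr.
  by rewrite addr_gt0// mulr_gt0.
have sqrt0 : A * eps `^ 2^-1 @[eps --> 0^'+] --> (0 : R).
  by rewrite -[X in _ --> X](mulr0 A); apply: cvgMr; apply: powR_cvg0; rewrite invr_gt0.
have upper0 : ((A * eps `^ 2^-1)%:E + L1norm a b (fun x => (u0 eps x - v x)%R))%E
    @[eps --> 0^'+] --> (0 : \bar R)%E.
  rewrite -[X in _ --> X](adde0 0%E); apply: cvgeD => //.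
  by apply: cvg_EFin sqrt0; apply: nearW.
apply: (squeeze_cvge _ (cvg_cst 0%E) upper0).
have d20 : 0 < delta / 2 by rewrite divr_gt0.
have near1 : \forall eps \near 0^'+, A * eps `^ 2^-1 < delta / 2.
  have /cvgrPdist_lt/(_ _ d20) := sqrt0; apply: filterS => eps.
  by rewrite sub0r normrN => /(le_lt_trans (ler_norm _)).
have near2 : \forall eps \near 0^'+, (L1norm a b (fun x => (u0 eps x - v x)%R) < (delta / 2)%:E)%E.
  have h1 := cvg_is_fine hu0.
  have h3 : fine (L1norm a b (fun x => (u0 eps x - v x)%R)) @[eps --> 0^'+] --> (0 : R).
    exact: fine_cvg hu0.
  have /cvgrPdist_lt/(_ _ d20) := h3.
  apply: filterS2 h1 => eps h1; rewrite sub0r normrN /= => /(le_lt_trans (ler_norm _)) h2.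
  by rewrite -(fineK h1) lte_fin.
near=> eps.
have eps0 : 0 < eps by near: eps; exact: nbhs_right_gt.
have eps1 : eps <= 1 by near: eps; exact: nbhs_right_le.
have small1 : A * eps `^ 2^-1 < delta / 2 by near: eps.
have small2 : (L1norm a b (fun x => (u0 eps x - v x)%R) < (delta / 2)%:E)%E by near: eps.
have Eeps : (energy n p a b eps (u0 eps) <= (N%:R * c_ n p + eps `^ K)%:E)%E by near: eps.
have [u00 [ut [hP heq]]] := neumann_path (hu _ eps0).
have hL2 := path_L2 hP.
have mD : measurable (`[a, b]%classic : set (measurableTypeR R)) by exact: measurable_itv.
have iu t : 0 <= t -> (@lebesgue_measure R).-integrable `[a, b] (EFin \o u eps t).
  by move=> t0; apply: (L2_integrable mD (lebesgue_itv_lty a b)); exact: hL2.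
have E0 : L1norm a b (fun x => u0 eps x - v x) = (L1dist a b (u eps 0) v)%:E.
  rewrite -L1norm_L1dist//; last exact: iu.
  by apply: eq_integral => x; rewrite inE/= in_itv/= => xab; rewrite u00.
rewrite E0 lte_fin in small2.
set T := l * eps `^ (- K).
set e0 := N%:R * c_ n p + eps `^ K.
set e1 := N%:R * c_ n p - C * eps `^ K.
have eK := powR_ge0 eps K.
have e10 : e1 <= e0.
  by rewrite /e1 /e0 lerD2l (@le_trans _ _ 0)// oppr_le0 mulr_ge0.
have start : energy_le n p a b eps (u eps) ut 0 e0.
  have h1 := le_trans (energy_le_eq_on n p eps u00) Eeps.
  exact: (energy_le_of_energy hp hnp hab eps0 hP (lexx 0) h1).
have stat r E : regular_time n p a b eps (u eps) ut r E -> L1dist a b (u eps r) v <= delta ->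
    E <= e0 -> e1 <= E.
  move=> [r0 hut [q [w [h1 h2 [h3 h4] h5 ->]]]] hd hE'.
  have [mur _] := hL2 r (ltW r0).
  apply: (static eps (u eps r) q) => //; first by rewrite eps0.
  exact: (subdifferential_integrable hp hnp eps0 (hL2 r (ltW r0)) h1 h2).
(* this weight balances the two terms of the displacement estimate: both are of
   order eps `^ 2^-1 *)
pose kappa := eps `^ (K + 2^-1).
have k0 : 0 < kappa by rewrite powR_gt0.
have halfE : kappa = eps `^ K * eps `^ 2^-1.
  by rewrite /kappa powRD// (gt_eqF eps0) implybT.
have sq : eps `^ 2^-1 * eps `^ 2^-1 = eps.
  rewrite -powRD ?(gt_eqF eps0) ?implybT//.
  by rewrite (_ : 2^-1 + 2^-1 = 1) ?powRr1 ?(ltW eps0)//; field.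
have eKgt : 0 < eps `^ K by rewrite powR_gt0.
have hgt : 0 < eps `^ 2^-1 by rewrite powR_gt0.
have om : kappa * (2 * T + 1) + (b - a) * expR 2 * eps / kappa * (e0 - e1) <=
    A * eps `^ 2^-1.
  have -> : e0 - e1 = (1 + C) * eps `^ K by rewrite /e0 /e1; ring.
  have -> : kappa * (2 * T + 1) = 2 * l * eps `^ 2^-1 + kappa.
    by rewrite /T powRN halfE; field; rewrite gt_eqF.
  have -> : (b - a) * expR 2 * eps / kappa * ((1 + C) * eps `^ K) =
      (b - a) * expR 2 * (1 + C) * eps `^ 2^-1.
    rewrite -[in X in X / _]sq halfE; field.
    by rewrite !gt_eqF.
  rewrite /A [X in _ <= X]mulrDl [X in _ <= X + _]mulrDl mul1r lerD2r lerD2l.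
  rewrite halfE ler_piMl ?(ltW hgt)//.
  by rewrite (le_trans (ger_powR (_ : 0 < eps <= 1) K0)) ?powRr0 ?eps0.
have close : L1dist a b (u eps 0) v +
    (kappa * (2 * T + 1) + (b - a) * expR 2 * eps / kappa * (e0 - e1)) < delta by lra.
have meta := metastability hp hnp hab eps0 hP heq iv k0 e10 start stat close.
apply/andP; split.
  apply: (@le_trans _ _ (L1norm a b (fun x => u eps 0 x - v x))); first exact: integral_ge0.
  apply: ereal_sup_ubound; exists 0 => //=.
  by rewrite lexx mulr_ge0 ?(ltW hl)// powR_ge0.
apply: ge_ereal_sup => _ [t /= tT <-]; have /andP[t0 _] := tT.
rewrite E0 L1norm_L1dist//; last exact: iu.
rewrite -EFinD lee_fin (le_trans (L1dist_triangle (iu t t0) (iu 0 (lexx 0)) iv))// lerD2r.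
exact: le_trans (meta t tT) om.
Unshelve. all: by end_near. Qed.
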